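(* Let $M$ be a connected matroid of rank $d$ on the ground set $[n]$, $n\geq 2$. Then $M$ is paving if and only if it is a split matroid such that each split flacet of $M$ has rank $d-1$.
   Context: A matroid of rank $d$ is paving if each of its circuits has either $d$ or $d+1$ elements. Let $M$ be a matroid of rank $d$ on $[n]$ with rank function $\operatorname{rk}$. The matroid polytope $P(M)\subset\mathbb{R}^n$ is the convex hull of the characteristic vectors of the bases of $M$; it is contained in the hypersimplex $\Delta(d,n)=P(U_{d,n})=[0,1]^n\cap\{\sum_i x_i=d\}$. For a flat $F$, let $P_M(F)=\{x\in P(M):\sum_{i\in F}x_i=\operatorname{rk}(F)\}$. A flacet of $M$ is a flat $F$ such that $P_M(F)$ is a facet of $P(M)$ and $F$ is minimal with respect to inclusion among all flats defining the same facet. The $F$-hyperplane is given by $(d-\operatorname{rk}(F))\sum_{i\in F}x_i=\operatorname{rk}(F)\sum_{j\notin F}x_j$, equivalently (on $\sum_i x_i=d$) by $\sum_{i\in F}x_i=\operatorname{rk}(F)$. A split of a polytope $P$ is a polytopal subdivision of $P$ (without new vertices) with exactly two maximal cells; its split hyperplane is the affine span of the common codimension-one cell. A split flacet of $M$ is a flacet $F$ such that the $F$-hyperplane defines a split of $\Delta(d,n)$. Two splits of a polytope $P$ are compatible if their split hyperplanes do not meet in a relatively interior point of $P$. The matroid $M$ is a split matroid if its split flacets form a compatible system of splits of the polytope $\operatorname{aff}(P(M))\cap[0,1]^n$, i.e. for any two distinct split flacets $F,G$ the $F$-hyperplane and the $G$-hyperplane do not meet in a relatively interior point of $\operatorname{aff}(P(M))\cap[0,1]^n$.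 If $M$ is connected then $\operatorname{aff}(P(M))\cap[0,1]^n=\Delta(d,n)$. *)

(* Defs.v *)
From HB Require Import structures.
From mathcomp Require Import all_boot all_order all_algebra.
From mathcomp Require Import all_classical all_reals topology normedtype.

Set Implicit Arguments.
Unset Strict Implicit.
Unset Printing Implicit Defensive.

Import Order.TTheory GRing.Theory Num.Theory.
Import numFieldNormedType.Exports.

Local Open Scope classical_set_scope.
Local Open Scope ring_scope.

(** * Matroids on a finite type *)

Record matroid (T : finType) := Matroid {
  bases : {set {set T}};
  bases_nonempty : exists B, B \in bases;
  bases_exchange : forall A B : {set T}, A \in bases -> B \in bases ->
    forall x, x \in A :\: B ->
    exists2 y, y \in B :\: A & y |: (A :\ x) \in bases
}.

Section Matroids.
Context (T : finType) (M : matroid T).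
Implicit Types A C F : {set T}.

Definition rk A : nat := (\max_(B in bases M) #|A :&: B|)%N.

Definition rank : nat := rk [set: T]%SET.

Definition indep A : bool := [exists B in bases M, A \subset B].

Definition circuit C : bool := minset (fun A => ~~ indep A) C.

Definition flat F : bool := [forall (x | x \notin F), rk F < rk (x |: F)]%N.

Definition paving : Prop :=
  forall C, circuit C -> #|C| = rank \/ #|C| = rank.+1.

(* [connected] already denotes topological connectedness. *)
Definition mconnected : Prop :=
  forall x y, x != y -> exists C, [/\ circuit C, x \in C & y \in C].

End Matroids.

(** * Convex geometry in R^n *)

Section Polytopes.
Context (R : realType) (n : nat).
Local Notation V := 'rV[R]_n.
Implicit Types (A P Q C : set V) (S : set (set V)).

Definition dot (a x : V) : R := \sum_i a 0 i * x 0 i.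

Definition conv A : set V := [set x : V | exists k (p : 'I_k -> V) (c : 'I_k -> R),
  [/\ forall i, A (p i), forall i, 0 <= c i, \sum_i c i = 1
    & x = \sum_i c i *: p i]].

Definition aff A : set V := [set x : V | exists k (p : 'I_k -> V) (c : 'I_k -> R),
  [/\ forall i, A (p i), \sum_i c i = 1 & x = \sum_i c i *: p i]].

Definition relint A : set V :=
  [set x : V | A x /\ \forall y \near x, aff A y -> A y].

Definition aff_indep k (p : 'I_k -> V) : Prop :=
  forall c : 'I_k -> R, \sum_i c i = 0 -> \sum_i c i *: p i = 0 ->
  forall i, c i = 0.

(* The maximal number of affinely independent points of [A] is [k]; that is,
   [A] has dimension [k - 1], the empty set having dimension -1. *)
Definition aff_rank A (k : nat) : Prop :=
  (exists2 p : 'I_k -> V, aff_indep p & forall i, A (p i)) /\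
  (forall p : 'I_k.+1 -> V, (forall i, A (p i)) -> ~ aff_indep p).

Definition polytope P : Prop := exists2 A, finite_set A & P = conv A.

(* The empty set and [P] itself are faces of [P]. *)
Definition face P Q : Prop := exists (a : V) (b : R),
  (forall x, P x -> dot a x <= b) /\ Q = P `&` [set x : V | dot a x = b].

Definition facet P Q : Prop :=
  face P Q /\ exists k, aff_rank P k.+1 /\ aff_rank Q k.

Definition polytopal_complex S : Prop :=
  [/\ finite_set S,
      forall C, S C -> polytope C,
      forall C Q, S C -> face C Q -> S Q
    & forall C C', S C -> S C' -> face C (C `&` C') /\ face C' (C `&` C')].

(* The last condition says that there are no new vertices. *)
Definition subdivision P S : Prop :=
  [/\ polytopal_complex S,
      \bigcup_(C in S) C = P
    & forall v : V, S [set v] -> face P [set v]].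

Definition maximal_cell S C : Prop :=
  S C /\ forall C', S C' -> C `<=` C' -> C' = C.

(* [H] is a subset of R^n, which cuts out the split hyperplane (the affine
   span of the common cell [C1 `&` C2]) in the affine span of [P]. *)
Definition defines_split P (H : set V) : Prop := exists S C1 C2,
  [/\ subdivision P S,
      C1 <> C2,
      forall C, maximal_cell S C <-> C = C1 \/ C = C2
    & aff (C1 `&` C2) = H `&` aff P].

Definition cube : set V := [set x : V | forall i, 0 <= x 0 i <= 1].

Definition hypersimplex (d : nat) : set V :=
  cube `&` [set x : V | \sum_i x 0 i = d%:R].

End Polytopes.

Arguments cube {R n}.
Arguments hypersimplex {R n} d.

(** * Matroid polytopes, flacets and split matroids *)

Section SplitMatroids.
Context (R : realType) (n : nat) (M : matroid 'I_n).
Local Notation V := 'rV[R]_n.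
Implicit Types F G : {set 'I_n}.

Definition charvec (B : {set 'I_n}) : V := \row_i (i \in B)%:R.

Definition matroid_polytope : set V :=
  conv [set x : V | exists2 B, B \in bases M & x = charvec B].

Definition flat_face F : set V :=
  matroid_polytope `&` [set x : V | \sum_(i in F) x 0 i = (rk M F)%:R].

Definition flacet F : Prop :=
  [/\ flat M F,
      facet matroid_polytope (flat_face F)
    & forall G, flat M G -> flat_face G = flat_face F -> G \subset F -> G = F].

Definition flat_hyperplane F : set V := [set x : V |
  ((rank M)%:R - (rk M F)%:R) * (\sum_(i in F) x 0 i)
  = (rk M F)%:R * (\sum_(j | j \notin F) x 0 j)].

Definition split_flacet F : Prop :=
  flacet F /\ defines_split (hypersimplex (rank M)) (flat_hyperplane F).

Definition split_matroid : Prop :=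
  forall F G, split_flacet F -> split_flacet G -> F <> G ->
  forall x : V, relint (aff matroid_polytope `&` cube) x ->
  ~ (flat_hyperplane F x /\ flat_hyperplane G x).

End SplitMatroids.

(* Main.v *)
Require Import Defs.
From mathcomp Require Import all_boot all_order all_algebra all_reals.
From mathcomp Require Import zify ring lra.

(** If [M] is paving, then a flat of rank less than [d - 1] is independent, so the
    hypersimplex lies on one side of its hyperplane, which therefore defines no
    split. Two distinct flats of rank [d - 1] meet in an independent set of size at
    most [d - 2]; hence a common interior point of their hyperplanes would have
    coordinate sum greater than [d], or else [M] would be disconnected.

    Conversely, let [B] be a [d]-set that is not a basis. Among the sets [F] with
    [M | F] connected and [rk F < #|B :&: F|], one of maximal size also has [M / F]
    connected. Then a linear form that vanishes on the bases spanning [F] is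
    constant on [F] and off [F], so [F] is a flacet; it is a split flacet and has
    rank [d - 1] by assumption, so [B] is contained in [F]. If [C] were a circuit of
    size less than [d] and [D] a [(d - 1)]-set containing it, this would give two
    distinct split flacets containing [D], whose hyperplanes meet in the interior of
    the hypersimplex. *)

Set Implicit Arguments.
Unset Strict Implicit.
Unset Printing Implicit Defensive.

(** * Matroid rank and connectivity *)

Section MatroidTheory.
Context (T : finType) (M : matroid T).
Implicit Types A B C D F G X Y : {set T}.

(** A [d]-set [B] is a basis exactly when its characteristic vector satisfies every inequality
    [sum F x <= rk F]; in the converse direction [F] is one that it violates, and connectivity of
    [M | F] and [M / F] is what makes this inequality facet-defining. Rank is governed by one
    exchange criterion: a basis that no single exchange improves for [A] attains [rk M A]. The same
    criterion turns a linear form vanishing on a face into separations, because its level sets are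
    met optimally by every basis of the face. The obstacle in producing splits is the absence of new
    vertices: it holds because the bound [rk F] is an integer, so cutting the hypersimplex along
    [sum F x = rk F] leaves only 0/1 vertices. Dimensions become matrix ranks, since all points lie
    on [sum x = d], which misses the origin. *)

Lemma setU_D A B : A :|: (B :\: A) = A :|: B.
Proof. by apply/setP=> z; rewrite !inE; case: (z \in A). Qed.

Lemma card_exchange A x y : x \in A -> y \notin A -> #|y |: (A :\ x)| = #|A|.
Proof.
move=> xA yA; rewrite cardsU1 !inE (negPf yA) andbF /=.
by rewrite (cardsD1 x A) xA.
Qed.

Lemma cardI_exchange A D x y : x \in A -> y \notin A ->
  (#|D :&: (y |: (A :\ x))| + (x \in D) = #|D :&: A| + (y \in D))%N.
Proof.
move=> xA yA.
have -> : D :&: (y |: (A :\ x)) = (D :&: [set y]) :|: ((D :&: A) :\ x).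
  by apply/setP=> z; rewrite !inE; do !case: (_ == _); do !case: (_ \in _).
rewrite cardsU.
have -> : D :&: [set y] :&: (D :&: A :\ x) = set0.
  apply/setP=> z; rewrite !inE; case: (eqVneq z y) => [->|]; last by rewrite andbF.
  by rewrite (negPf yA) !andbF.
rewrite cards0 subn0 (cardsD1 x (D :&: A)) inE xA andbT.
have -> : #|D :&: [set y]| = (y \in D).
  case yD: (y \in D); first by rewrite (setIidPr _) ?cards1 ?sub1set.
  by apply/eqP; rewrite cards_eq0 setI_eq0 disjoint_sym disjoints1 yD.
lia.
Qed.

Lemma card_bases A B : A \in bases M -> B \in bases M -> #|A| = #|B|.
Proof.
elim: {A}_.+1 {-2}A (ltnSn #|A :\: B|) => // k IH A leAk Ab Bb.
have [AB0|/set0Pn[x xAB]] := eqVneq (A :\: B) set0.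
  have [BA0|/set0Pn[x xBA]] := eqVneq (B :\: A) set0.
    congr #|pred_of_set _|; apply/eqP; rewrite eqEsubset -!setD_eq0.
    by rewrite AB0 BA0 eqxx.
  by have [y] := bases_exchange Bb Ab xBA; rewrite AB0 inE.
have [y yBA A'b] := bases_exchange Ab Bb xAB.
move: xAB yBA; rewrite !inE => /andP[xB xA] /andP[yA yB].
rewrite -(card_exchange xA yA); apply: IH => //.
rewrite -ltnS; apply: leq_trans leAk; rewrite ltnS; apply: proper_card.
apply/properP; split.
  apply/subsetP => z; rewrite !inE => /andP[zB /orP[/eqP zy|/andP[]//]].
    by rewrite zy yB in zB.
  by rewrite zB.
exists x; rewrite !inE ?xB ?xA // eqxx /= orbF.
by apply: contraNneq xB => ->.
Qed.

Lemma leq_rk A B : B \in bases M -> #|A :&: B| <= rk M A.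
Proof. by move=> Bb; rewrite /rk (bigmax_sup B). Qed.

Lemma rk_witness A : exists2 B, B \in bases M & #|A :&: B| = rk M A.
Proof.
have [B0 B0b] := bases_nonempty M.
rewrite /rk; have [|B Bb ->] := @eq_bigmax_cond _ (mem (bases M)) (fun B => #|A :&: B|).
  by apply/card_gt0P; exists B0.
by exists B.
Qed.

Lemma basis_rank B : B \in bases M -> #|B| = rank M.
Proof.
move=> Bb; have [C Cb eC] := rk_witness setT; rewrite /rank -eC setTI.
exact: card_bases.
Qed.

Lemma rk_card A : rk M A <= #|A|.
Proof. by have [B _ <-] := rk_witness A; rewrite subset_leq_card ?subsetIl. Qed.

Lemma rkS A B : A \subset B -> rk M A <= rk M B.
Proof.
move=> AB; have [C Cb <-] := rk_witness A.
by apply: leq_trans (leq_rk B Cb); rewrite subset_leq_card ?setSI.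
Qed.

Lemma rk_rank A : rk M A <= rank M.
Proof. exact: rkS (subsetT A). Qed.

(** Local optimality implies global optimality. Among the bases [J] meeting [A] in more elements
    than [B] does, the one closest to [B] has [J :\: B] inside [A]: exchanging an element of [J]
    outside [A] towards [B] would bring it closer at no loss. Dropping from [B] an element outside
    [A] and [J] then brings in an element of [A]. *)
Lemma rk_leq_basis A B : B \in bases M ->
  (forall i j, i \in A :\: B -> j \in B :\: A -> i |: (B :\ j) \notin bases M) ->
  rk M A <= #|A :&: B|.
Proof.
move=> Bb noex; rewrite leqNgt; apply/negP => lt.
have [J0 J0b J0A] := rk_witness A.
pose P J := (J \in bases M) && (#|A :&: B| < #|A :&: J|).
have PJ0 : P J0 by rewrite /P J0b J0A.
case: (@arg_maxnP _ J0 P (fun J => #|B :&: J|) PJ0) => J /andP[Jb ltJ] maxJ.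
have JBA : J :\: B \subset A.
  apply/subsetP => x xJB; apply/negPn/negP => xA.
  have [y yBJ J'b] := bases_exchange Jb Bb xJB.
  move: xJB yBJ; rewrite !inE => /andP[xB xJ] /andP[yJ yB].
  have eA := cardI_exchange A xJ yJ; have eB := cardI_exchange B xJ yJ.
  have := maxJ (y |: J :\ x); rewrite /P J'b /=; move: eA eB.
  by rewrite (negPf xA) (negPf xB) yB; move: ltJ; clear; lia.
have /set0Pn[j] : B :\: A :\: J != set0.
  apply/negP => /eqP /eqP; rewrite setD_eq0 => sub.
  have : #|B :\: A| <= #|J :\: A|.
    apply/subset_leq_card/subsetP => z zBA; have := subsetP sub z zBA.
    by move: zBA; rewrite !inE => /andP[-> _] ->.
  have := card_bases Bb Jb; rewrite -(cardsID A B) -(cardsID A J) !(setIC _ A).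
  lia.
rewrite !inE => /and3P[jJ jA jB].
have [|i iJB B'b] := bases_exchange Bb Jb (x := j); first by rewrite !inE jJ.
have iA := subsetP JBA _ iJB.
by move: (noex i j); rewrite !inE iA jA jB B'b andbT; move: iJB; rewrite !inE => /andP[-> _] /(_ isT isT).
Qed.

(** Maximise the meet with [X] among the bases optimal for [Y]. An exchange that gains in [X] puts
    in an element of [Y], so it loses nothing in [Y], and the local criterion applies. *)
Lemma rk_witness2 X Y : X \subset Y -> exists B,
  [/\ B \in bases M, #|X :&: B| = rk M X & #|Y :&: B| = rk M Y].
Proof.
move=> XY; have [B0 B0b B0Y] := rk_witness Y.
pose P B := (B \in bases M) && (#|Y :&: B| == rk M Y).
have PB0 : P B0 by rewrite /P B0b B0Y eqxx.
case: (@arg_maxnP _ B0 P (fun B => #|X :&: B|) PB0) => B /andP[Bb /eqP BY] maxB.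
exists B; split=> //; apply/eqP; rewrite eqn_leq leq_rk //=.
apply: rk_leq_basis => // i j; rewrite !inE => /andP[iB iX] /andP[jX jB].
apply/negP => B'b.
have eX := cardI_exchange X jB iB; have eY := cardI_exchange Y jB iB.
have := maxB (i |: B :\ j); rewrite /P B'b /=.
have := leq_rk Y B'b; move: eX eY.
by rewrite iX (subsetP XY _ iX) (negPf jX) BY; clear; lia.
Qed.

(** A basis optimal for both the intersection and the union reduces this to counting. *)
Lemma rk_submod A B : rk M (A :|: B) + rk M (A :&: B) <= rk M A + rk M B.
Proof.
have [|D [Db <- <-]] := @rk_witness2 (A :&: B) (A :|: B).
  by rewrite (subset_trans (subsetIl _ _)) ?subsetUl.
rewrite setIUl setIIl cardsUI.
by rewrite leq_add ?leq_rk.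
Qed.

Lemma indepE A : indep M A = (rk M A == #|A|).
Proof.
apply/existsP/eqP => [[B /andP[Bb AB]]|eA].
  by apply/eqP; rewrite eqn_leq rk_card -{1}(setIidPl AB) leq_rk.
have [B Bb AB] := rk_witness A; exists B; rewrite Bb /=.
by apply/setIidPl/eqP; rewrite eqEcard subsetIl AB eA leqnn.
Qed.

Lemma circuitP C : circuit M C ->
  ~~ indep M C /\ (forall A, A \proper C -> indep M A).
Proof.
move=> /minsetP[depC minC]; split=> // A pAC; apply: contraT => depA.
by have e := minC A depA (proper_sub pAC); rewrite e properxx in pAC.
Qed.

Lemma rk_circuit C : circuit M C -> (rk M C).+1 = #|C|.
Proof.
move=> /circuitP[]; rewrite indepE => dC indC.
have [C0|/set0Pn[x xC]] := eqVneq C set0.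
  by move: dC (rk_card C); rewrite C0 cards0; case: (rk _ _).
have := indC (C :\ x) (properD1 xC); rewrite indepE => /eqP eCx.
have := rkS (subsetDl C [set x]); have := rk_card C; move: dC eCx.
by rewrite [#|C|](cardsD1 x) xC; lia.
Qed.

Lemma dep_circuit A : ~~ indep M A -> exists2 C, circuit M C & C \subset A.
Proof. by move=> dA; have [C CP CA] := @minset_exists _ (fun A => ~~ indep M A) A dA; exists C. Qed.

Lemma circuit_rank C : circuit M C -> #|C| <= (rank M).+1.
Proof. by move/rk_circuit <-; rewrite ltnS rk_rank. Qed.

Lemma flat_rk_lt F G : flat M F -> ~~ (G \subset F) -> rk M F < rk M (F :|: G).
Proof.
move=> /forallP flF /subsetPn[x xG xF].
have := flF x; rewrite xF /= => /leq_trans; apply; apply: rkS.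
by rewrite setUC setUS // sub1set.
Qed.

Lemma rk_lt_notin F : rk M F < rank M -> exists e, e \notin F.
Proof.
move=> ltF; apply/existsP; apply: contraTT ltF => /existsPn FT.
have -> : F = setT by apply/setP => j; rewrite inE; apply: negbNE.
by rewrite ltnn.
Qed.

Lemma flat_rank F : flat M F -> rk M F = rank M -> F = setT.
Proof.
move=> flF eF; apply/eqP; rewrite eqEsubset subsetT /=.
by apply/negPn/negP => /(flat_rk_lt flF); rewrite eF ltnNge rk_rank.
Qed.

Lemma paving_small A : paving M -> (rk M A).+1 < rank M -> rk M A = #|A|.
Proof.
move=> pav ltA; apply/eqP; rewrite -indepE; apply: contraT => /dep_circuit[C CM CA].
 have := rkS CA; have := rk_circuit CM.
by case: (pav C CM); lia.
Qed.

(** Connectedness of the restriction [M | F]: by submodularity the ranks of two complementary parts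
    always add up to at least [rk M F], and equality would make them direct summands. *)
Definition rconnected F := forall A,
  A != set0 -> A \proper F -> rk M F < rk M A + rk M (F :\: A).

(* [rconnected] for the contraction [M / F], in terms of the ranks of [M]. *)
Definition cconnected F := forall A,
  F \proper A -> A \proper setT -> rank M + rk M F < rk M A + rk M (F :|: ~: A).

(** A circuit through both sides of a separation meets each side in an independent set; two
    applications of submodularity then give it rank at least its size. *)
Lemma mconnected_rk : mconnected M -> rconnected setT.
Proof.
move=> conn A /set0Pn[x xA] /properP[_ [y _ yA]].
rewrite ltnNge setTD; apply/negP => le.
have [|C [CM xC yC]] := conn x y; first by apply: contraNneq yA => <-.
have [_ indC] := circuitP CM.
have /eqP e1 : rk M (C :&: A) == #|C :&: A|.
  by rewrite -indepE indC //; apply/properP; split; [exact: subsetIl|exists y; rewrite // inE (negPf yA) andbF].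
have /eqP e2 : rk M (C :\: A) == #|C :\: A|.
  by rewrite -indepE indC //; apply/properP; split; [exact: subsetDl|exists x; rewrite // inE xA].
have s1 := rk_submod C A; have s2 := rk_submod (C :|: A) (~: A).
have uT : C :|: A :|: ~: A = setT by rewrite -setUA setUCr setUT.
have iD : (C :|: A) :&: ~: A = C :\: A by rewrite setIUl setICr setU0 setDE.
move: s2; rewrite uT iD -[rk M setT]/(rank M) => s2.
have := cardsID A C; have := rk_circuit CM; rewrite -[rk M setT]/(rank M) in le.
lia.
Qed.

(** A separation of [X :|: Y] restricts to a separation of [F] unless [F] lies on one side. *)
Lemma rconnected_sep F X Y : rconnected F -> F \subset X :|: Y -> [disjoint X & Y] ->
  rk M X + rk M Y <= rk M (X :|: Y) -> F \subset X \/ F \subset Y.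
Proof.
move=> conF FXY dXY le.
have FY : F :\: (F :&: X) = F :&: Y.
  apply/setP => z; rewrite !inE; case zF: (z \in F) => //=; rewrite ?andbF // andbT.
  move: (subsetP FXY z zF); rewrite inE; case zX: (z \in X) => /= zXY; last by rewrite zXY.
  by rewrite (disjointFr dXY zX).
have [e|n0] := eqVneq (F :&: X) set0.
  by right; apply/setIidPl; rewrite -FY e setD0.
have [|nFX] := boolP (F \subset X); first by left.
have := conF _ n0; rewrite FY properE subsetIl subsetI subxx nFX => /(_ isT).
have s1 := rk_submod (X :|: F) Y; have s2 := rk_submod X F.
have : rk M (F :&: Y) <= rk M ((X :|: F) :&: Y) by rewrite rkS // setSI // subsetUr.
have : rk M (X :|: Y) <= rk M (X :|: F :|: Y) by rewrite rkS // setSU // subsetUl.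
move: s1 s2; rewrite (setIC X F); lia.
Qed.

Lemma violated_flat B : rconnected setT -> #|B| = rank M -> B \notin bases M ->
  exists F, [/\ rconnected F, cconnected F & rk M F < #|B :&: F|].
Proof.
move=> conM cardB Bnb.
pose viol F := rk M F < #|B :&: F|.
pose rconnb F := [forall A, (A != set0) ==> (A \proper F) ==>
    (rk M F < rk M A + rk M (F :\: A))].
have rconnP F : rconnected F <-> rconnb F.
  split=> [cF|/forallP cF A A0 AF].
    by apply/forallP => A; apply/implyP => A0; apply/implyP; exact: cF.
  by have /implyP/(_ A0)/implyP/(_ AF) := cF A.
have vB : viol B.
  rewrite /viol setIid ltn_neqAle rk_card andbT -indepE.
  apply: contra Bnb => /existsP[D /andP[Db BD]].
  suff -> : B = D by [].
  by apply/eqP; rewrite eqEcard BD (basis_rank Db) cardB leqnn.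
(* A violated set of least size is connected: the ranks of the parts of a separation sum to at most
   its rank, so one part would be violated as well. *)
have [F0 PF0] : exists F, viol F && rconnb F.
  case: (@arg_minnP _ B viol (fun F => #|F|) vB) => F vF minF.
  exists F; rewrite vF; apply/rconnP => A A0 AF; rewrite ltnNge; apply/negP => le.
  have cA : #|A| < #|F| by exact: proper_card.
  have cDA : #|F :\: A| < #|F|.
    apply: proper_card; apply/properP; split; first exact: subsetDl.
    by case/set0Pn: A0 => x xA; exists x; rewrite ?(subsetP (proper_sub AF)) // inE xA.
  have := minF A; have := minF (F :\: A).
  have : #|B :&: F| <= #|B :&: A| + #|B :&: (F :\: A)|.
    rewrite -cardsUI -setIUr; apply: leq_trans (leq_addr _ _).
    by rewrite subset_leq_card // setIS // setU_D subsetUr.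
  by move: vF cA cDA le; rewrite /viol; clear; lia.
case: (@arg_maxnP _ F0 (fun F => viol F && rconnb F) (fun F => #|F|) PF0).
move=> F /andP[vF /rconnP cF] maxF; exists F; split=> // A FA AT.
rewrite ltnNge; apply/negP => le.
(* A violated side [X] of a separation of [M / F] is again connected: a
   separator of [X] avoiding [F] would separate all of [M]. *)
have enlarge X : F \proper X -> X \proper setT -> viol X ->
    rk M X + rk M (F :|: ~: X) <= rank M + rk M F -> False.
  move=> FX XT vX leX.
  have := maxF X; rewrite vX /=; have := proper_card FX.
  suff /rconnP cX : rconnected X by rewrite cX => lFX /(_ isT); rewrite leqNgt lFX.
  move=> Y Y_neq0 YltX; rewrite ltnNge; apply/negP => leY.
  have FsX := proper_sub FX; have YX := proper_sub YltX.
  have uY : Y :|: (X :\: Y) = X.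
    by rewrite setU_D; apply/setUidPr.
  have dY : [disjoint Y & X :\: Y].
    by rewrite -setI_eq0; apply/eqP/setP => z; rewrite !inE; case: (z \in Y).
  have key Z W : Z != set0 -> Z :|: W = X -> [disjoint Z & W] ->
      rk M Z + rk M W <= rk M X -> F \subset W -> False.
    move=> Z0 uZ dZ leZ FW.
    have ZX : Z \subset X by rewrite -uZ subsetUl.
    have ZT : Z \proper setT by apply: sub_proper_trans XT.
    have := conM Z Z0 ZT; rewrite -[rk M setT]/(rank M).
    have -> : setT :\: Z = W :|: (F :|: ~: X).
      rewrite setUA (setUidPl FW) setTD -uZ; apply/setP => z; rewrite !inE.
      by case zZ: (z \in Z) => //=; rewrite ?(disjointFr dZ zZ) //; case: (z \in W).
    have := rk_submod W (F :|: ~: X).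
    have : rk M F <= rk M (W :&: (F :|: ~: X)).
      by rewrite rkS // subsetI FW subsetUl.
    move: leZ leX; clear; lia.
  have [||FY|FY] := rconnected_sep cF _ dY; rewrite ?uY //.
    apply: (key (X :\: Y) Y) => //; rewrite ?(addnC (rk M (_ :\: _))) //.
    - by rewrite setD_eq0; case/andP: YltX.
    - by rewrite setUC.
    - by rewrite disjoint_sym.
  exact: (key Y (X :\: Y)).
have FsA := proper_sub FA.
pose A2 := F :|: ~: A.
have cA2 : F :|: ~: A2 = A.
  rewrite /A2 setCU setCK setIC -setDE setU_D; exact/setUidPr.
(* [A] and [A2] cover everything and meet in [F], so their counts in [B] exceed the total rank that
   the separation allows: one of the two is violated. *)
have cnt : #|B :&: A| + #|B :&: A2| = rank M + #|B :&: F|.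
  rewrite -cardsUI -setIUr -setIIr.
  have -> : A :|: A2 = setT by rewrite /A2 setUCA setUCr setUT.
  have -> : A :&: A2 = F by rewrite /A2 setIUr setICr setU0; apply/setIidPr.
  by rewrite setIT cardB.
have [vA|nvA] := boolP (viol A); first exact: (enlarge A).
apply: (enlarge A2); last by rewrite cA2 addnC.
- rewrite properE subsetUl /= /A2 subUset subxx /=.
  apply/subsetPn; case/properP: AT => _ [z _ zA]; exists z; rewrite ?inE ?zA //.
  by apply: contra zA => /(subsetP FsA).
- case/properP: FA => _ [z zA zF]; apply/properP; split; rewrite ?subsetT //.
  by exists z; rewrite // !inE zA (negPf zF).
move: nvA le cnt vF; rewrite /viol -/A2; clear; lia.
Qed.

(** An element outside [F] that does not raise the rank is a loop of [M / F], hence a separation. *)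
Lemma cconnected_flat F : cconnected F -> rk M F < rank M -> flat M F.
Proof.
move=> cF ltF; apply/forallP => x; apply/implyP => xF.
rewrite ltnNge; apply/negP => le.
have pF : F \proper x |: F.
  apply/properP; split; first exact: subsetUr.
  by exists x; rewrite // setU11.
have pT : x |: F \proper setT.
  rewrite properT; apply: contraTneq ltF => e; rewrite -leqNgt.
  by move: le; rewrite e.
have := cF _ pF pT; have := rk_rank (F :|: ~: (x |: F)); lia.
Qed.

(** * Functions that are constant along exchanges within a face *)

Section ConstantOnFace.
Variables (U : eqType) (a : T -> U) (F : {set T}).
Hypothesis exchange_eq : forall B i j, B \in bases M -> #|F :&: B| = rk M F ->
  i \notin B -> j \in B -> i |: (B :\ j) \in bases M ->
  #|F :&: (i |: (B :\ j))| = rk M F -> a i = a j.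

Lemma rk_level A B : B \in bases M -> #|F :&: B| = rk M F ->
  (forall i j, i \in A -> j \notin A ->
     (j \in F -> i \in F) /\ ((i \in F) = (j \in F) -> a i != a j)) ->
  rk M A <= #|A :&: B|.
Proof.
move=> Bb FB lev; apply: rk_leq_basis => // i j.
rewrite !inE => /andP[iB iA] /andP[jA jB]; apply/negP => B'b.
have [jiF neq] := lev i j iA jA.
have e := cardI_exchange F jB iB; have le := leq_rk F B'b.
have eF : (i \in F) = (j \in F).
  move: jiF e le; rewrite FB; case: (i \in F); case: (j \in F) => //=.
    by clear; lia.
  by move=> /(_ isT).
have /eqP := neq eF; apply; apply: (exchange_eq Bb) => //.
by move: e; rewrite FB eF; clear; lia.
Qed.

(** A level set in [F] and the rest of [F] are met optimally by the same basis, so their ranks add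
    up to [rk M F], which is a separation unless the rest is empty. *)
Lemma rconnected_const : rconnected F -> {in F &, forall i j, a i = a j}.
Proof.
move=> cF i j iF jF; apply/eqP; apply: contraT => aij.
have [B Bb FB] := rk_witness F.
pose A := [set k in F | a k == a i].
have AF : A \subset F by apply/subsetP => k; rewrite inE => /andP[].
have := cF A; have -> : A != set0 by apply/set0Pn; exists i; rewrite inE iF eqxx.
have -> : A \proper F.
  by apply/properP; split=> //; exists j; rewrite // inE jF /= eq_sym.
move=> /(_ isT isT).
have := @rk_level A B Bb FB; have := @rk_level (F :\: A) B Bb FB.
have : #|A :&: B| + #|(F :\: A) :&: B| = rk M F.
  by rewrite -FB -(cardsID A (F :&: B)) setIAC (setIidPr AF) setDE setIAC -setDE.
move=> <- h1 h2; rewrite ltnNge leq_add //; [apply: h2|apply: h1] => k l.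
  rewrite !inE => /andP[kF /eqP ak] lA; rewrite kF; split=> // lF.
  by move: lA; rewrite -lF ak /= eq_sym.
rewrite !inE => /andP[nk kF] lA; rewrite kF; split=> // lF.
by move: nk lA; rewrite kF -lF /= andbT negbK => nk /eqP ->.
Qed.

(** The same argument in [M / F]: [F] is added both to a level set and to the complement, and one
    basis is optimal for both. *)
Lemma cconnected_const : cconnected F ->
  {in [predC F] &, forall i j, a i = a j}.
Proof.
move=> cF i j; rewrite !inE => iF jF; apply/eqP; apply: contraT => aij.
have [B Bb FB] := rk_witness F.
pose A := F :|: [set k | a k == a i].
have FA : F \subset A by exact: subsetUl.
have := cF A; have -> : F \proper A.
  by apply/properP; split=> //; exists i; rewrite // !inE eqxx orbT.
have -> : A \proper setT.
  apply/properP; split; rewrite ?subsetT //; exists j => //.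
  by rewrite !inE (negPf jF) /= eq_sym.
move=> /(_ isT isT).
have := @rk_level A B Bb FB; have := @rk_level (F :|: ~: A) B Bb FB.
have : #|A :&: B| + #|(F :|: ~: A) :&: B| = rank M + rk M F.
  rewrite -cardsUI -setIUl -setIIl setUCA setUCr setUT setTI basis_rank //.
  by rewrite setIUr setICr setU0 (setIidPr FA) FB.
move=> <- h1 h2; rewrite ltnNge leq_add //; [apply: h2|apply: h1] => k l.
  rewrite !inE negb_or => kA /andP[lF la]; rewrite (negPf lF); split=> // kF.
  by move: kA; rewrite kF /= => /eqP ->; rewrite eq_sym.
rewrite !inE !negb_or !negb_and !negbK => kA /andP[lF].
rewrite (negPf lF) /= => /eqP la; split=> // kF.
by move: kA; rewrite kF la.
Qed.

End ConstantOnFace.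

End MatroidTheory.

From mathcomp Require Import all_classical topology normedtype.

Import Order.TTheory GRing.Theory Num.Theory.
Import numFieldNormedType.Exports.

Local Open Scope classical_set_scope.
Local Open Scope ring_scope.

(** * Convex hulls and splits *)

Section Convexity.
Context (R : realType) (n : nat).
Local Notation V := 'rV[R]_n.
Implicit Types (a x y : V) (A C P Q : set V) (b t : R) (F G B : {set 'I_n}).

Lemma dotDr a x y : dot a (x + y) = dot a x + dot a y.
Proof. by rewrite /dot -big_split; apply: eq_bigr => i _; rewrite mxE mulrDr. Qed.

Lemma dotZr a t x : dot a (t *: x) = t * dot a x.
Proof. by rewrite /dot big_distrr; apply: eq_bigr => i _; rewrite mxE mulrCA. Qed.

Lemma dotC a x : dot a x = dot x a.
Proof. by apply: eq_bigr => i _; rewrite mulrC. Qed.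

Lemma dotDl a x y : dot (x + y) a = dot x a + dot y a.
Proof. by rewrite !(dotC _ a) dotDr. Qed.

Lemma dotZl a t x : dot (t *: x) a = t * dot x a.
Proof. by rewrite !(dotC _ a) dotZr. Qed.

Lemma dotNr a x : dot a (- x) = - dot a x.
Proof. by rewrite -scaleN1r dotZr mulN1r. Qed.

Lemma dotNl a x : dot (- x) a = - dot x a.
Proof. by rewrite !(dotC _ a) dotNr. Qed.

Lemma dotBr a x y : dot a (x - y) = dot a x - dot a y.
Proof. by rewrite dotDr dotNr. Qed.

Lemma dot0l x : dot 0 x = 0.
Proof. by rewrite -(scale0r 0) dotZl mul0r. Qed.

Lemma dot_sumr a (J : finType) (K : pred J) (c : J -> R) (p : J -> V) :
  dot a (\sum_(j | K j) c j *: p j) = \sum_(j | K j) c j * dot a (p j).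
Proof.
elim/big_rec2: _ => [|j u v _ <-]; first by rewrite dotC dot0l.
by rewrite dotDr dotZr.
Qed.

Lemma dot_suml x (J : finType) (K : pred J) (p : J -> V) :
  dot (\sum_(j | K j) p j) x = \sum_(j | K j) dot (p j) x.
Proof.
elim/big_rec2: _ => [|j u v _ <-]; first by rewrite dot0l.
by rewrite dotDl.
Qed.

Lemma dot_delta i x : dot (delta_mx 0 i) x = x 0 i.
Proof.
rewrite /dot (bigD1 i) //= big1 ?addr0 ?mxE ?eqxx ?mul1r // => j ji.
by rewrite mxE (negPf ji) andbF mul0r.
Qed.

Lemma dot_charvec F x : dot (charvec R F) x = \sum_(i in F) x 0 i.
Proof.
rewrite /dot [RHS]big_mkcond; apply: eq_bigr => i _; rewrite mxE.
by case: (i \in F); rewrite ?mul1r ?mul0r.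
Qed.

Lemma sum_coord x : \sum_i x 0 i = dot (charvec R [set: 'I_n]%SET) x.
Proof. by rewrite dot_charvec; apply: eq_bigl => i; rewrite inE. Qed.

Lemma dot_charvec2 F B : dot (charvec R F) (charvec R B) = #|F :&: B|%:R.
Proof.
rewrite dot_charvec -sum1_card natr_sum big_mkcond [RHS]big_mkcond.
by apply: eq_bigr => i _; rewrite mxE inE; case: (i \in F); case: (i \in B).
Qed.

Lemma charvecC F : charvec R (~: F) = charvec R [set: 'I_n]%SET - charvec R F.
Proof.
by apply/rowP => i; rewrite !mxE !inE; case: (i \in F); rewrite ?subrr ?subr0.
Qed.

Lemma sum_coordC F x :
  \sum_(j | j \notin F) x 0 j = dot (charvec R [set: 'I_n]%SET) x - dot (charvec R F) x.
Proof.
by rewrite -dotNl -dotDl -charvecC dot_charvec; apply: eq_bigl => j; rewrite inE.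
Qed.

Lemma sub_conv A : A `<=` conv A.
Proof.
move=> x Ax; exists 1%N, (fun=> x), (fun=> 1); split=> //.
  by rewrite big_ord1.
by rewrite big_ord1 scale1r.
Qed.

Lemma big_support (U : nmodType) (J : finType) (K : pred J) (f : J -> U) :
  (forall j, ~~ K j -> f j = 0) -> \sum_(i < #|K|) f (enum_val i) = \sum_j f j.
Proof.
by move=> f0; rewrite -(big_enum_val (A := K) f) [RHS](bigID K) /= [X in _ + X]big1 ?addr0.
Qed.

(** Any finite index type is allowed, and points of coefficient 0 may lie outside [A]; sums over sum
    types and dependent pairs thus serve directly as convex combinations. *)
Lemma conv_fin A (J : finType) (p : J -> V) (c : J -> R) :
  (forall j, c j != 0 -> A (p j)) -> (forall j, 0 <= c j) -> \sum_j c j = 1 ->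
  conv A (\sum_j c j *: p j).
Proof.
move=> Ap c0 c1; pose K := [pred j | c j != 0].
exists #|K|, (fun i => p (enum_val i)), (fun i => c (enum_val i)); split=> //.
- by move=> i; apply: Ap; have := enum_valP i.
- by rewrite (@big_support _ _ K c) // => j /negPn/eqP.
- rewrite (@big_support _ _ K (fun j => c j *: p j)) // => j /negPn/eqP ->.
  by rewrite scale0r.
Qed.

Lemma aff_fin A (J : finType) (p : J -> V) (c : J -> R) :
  (forall j, c j != 0 -> A (p j)) -> \sum_j c j = 1 ->
  aff A (\sum_j c j *: p j).
Proof.
move=> Ap c1; pose K := [pred j | c j != 0].
exists #|K|, (fun i => p (enum_val i)), (fun i => c (enum_val i)); split=> //.
- by move=> i; apply: Ap; have := enum_valP i.
- by rewrite (@big_support _ _ K c) // => j /negPn/eqP.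
- rewrite (@big_support _ _ K (fun j => c j *: p j)) // => j /negPn/eqP ->.
  by rewrite scale0r.
Qed.

Lemma sub_aff A : A `<=` aff A.
Proof.
move=> x Ax; exists 1%N, (fun=> x), (fun=> 1); split=> //.
  by rewrite big_ord1.
by rewrite big_ord1 scale1r.
Qed.

Lemma conv_sub_aff A : conv A `<=` aff A.
Proof. by move=> x [k [p [c [Ap _ c1 ->]]]]; exists k, p, c. Qed.

Lemma conv_dot_le A a b : (forall x, A x -> dot a x <= b) ->
  forall x, conv A x -> dot a x <= b.
Proof.
move=> Aab x [k [p [c [Ap c0 c1 ->]]]]; rewrite dot_sumr -[b]mul1r -c1 big_distrl.
by apply: ler_sum => i _; apply: ler_wpM2l => //; exact: Aab.
Qed.

Lemma aff_dot_eq A a b : (forall x, A x -> dot a x = b) ->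
  forall x, aff A x -> dot a x = b.
Proof.
move=> Aab x [k [p [c [Ap c1 ->]]]]; rewrite dot_sumr -[b]mul1r -c1 big_distrl.
by apply: eq_bigr => i _; rewrite Aab.
Qed.

Lemma conv_conv A : conv (conv A) `<=` conv A.
Proof.
move=> x [k [p [c [Ap c0 c1 ->]]]].
have /choice[f fP] (i : 'I_k) : exists f : {m : nat & (('I_m -> V) * ('I_m -> R))%type},
    [/\ forall j, A ((tagged f).1 j), forall j, 0 <= (tagged f).2 j,
     \sum_j (tagged f).2 j = 1 & p i = \sum_j (tagged f).2 j *: (tagged f).1 j].
  by have [m [q [e [Aq e0 e1 pe]]]] := Ap i; exists (existT _ m (q, e)).
pose J := {i : 'I_k & 'I_(tag (f i))}.
have -> : \sum_i c i *: p i =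
    \sum_(s : J) (c (tag s) * (tagged (f (tag s))).2 (tagged s)) *:
                 (tagged (f (tag s))).1 (tagged s).
  transitivity (\sum_i \sum_j (c i * (tagged (f i)).2 j) *: (tagged (f i)).1 j).
    apply: eq_bigr => i _; have [_ _ _ {1}->] := fP i.
    by rewrite scaler_sumr; apply: eq_bigr => j _; rewrite scalerA.
  by rewrite sig_big_dep.
apply: conv_fin.
- by move=> s _; have [] := fP (tag s).
- by move=> s; apply: mulr_ge0 => //; have [] := fP (tag s).
transitivity (\sum_i \sum_j (c i * (tagged (f i)).2 j)); first by rewrite sig_big_dep.
rewrite -c1; apply: eq_bigr => i _; rewrite -big_distrr /=.
by have [_ _ -> _] := fP i; rewrite mulr1.
Qed.

Lemma conv2 A x y t : conv A x -> conv A y -> 0 <= t <= 1 ->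
  conv A (t *: x + (1 - t) *: y).
Proof.
move=> Ax Ay /andP[t0 t1]; apply: conv_conv.
have -> : t *: x + (1 - t) *: y =
    \sum_(j : bool) (if j then t else 1 - t) *: (if j then x else y).
  by rewrite big_bool.
apply: conv_fin; first by case.
  by case; rewrite ?subr_ge0.
by rewrite big_bool /= addrC subrK.
Qed.

(* Both cells of a split contain points off the split hyperplane; if these were
   on the same side, then the cones over [C1 `&` C2] from them would overlap. *)
Lemma not_split_one_side P H a b : defines_split P H ->
  (forall x, aff P x -> H x <-> dot a x = b) ->
  (exists2 x, aff P x & dot a x = b) ->
  (forall x, P x -> dot a x <= b) -> False.
Proof.
move=> [S [C1 [C2 [[[_ Spol _ Sface] SP _] neC maxC affC]]]] Hab [y0 Py0 y0b] Pab.
have [[S1 m1] [S2 m2]] : maximal_cell S C1 /\ maximal_cell S C2.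
  by split; apply/maxC; [left|right].
have SsubP C : S C -> C `<=` P by move=> SC x Cx; rewrite -SP; exists C.
have affE x : aff P x -> dot a x = b -> aff (C1 `&` C2) x.
  by move=> Px xb; rewrite affC; split=> //; apply/Hab.
(* The form that cuts the face out of [C] is constant on its affine span, which is the whole split
   hyperplane; a point of [C] outside [C'] therefore lies off that hyperplane. *)
have offH C C' : S C -> (C `&` C' = C1 `&` C2) -> face C (C `&` C') -> ~ C `<=` C' ->
    exists q, [/\ C q, P q & dot a q < b].
  move=> SC eC [a1 [b1 [le1 e1]]] /existsNP[q /not_implyP[Cq nC'q]].
  have Pq := SsubP _ SC _ Cq; exists q; split=> //.
  rewrite lt_neqAle Pab // andbT; apply/eqP => qb; apply: nC'q.
  have : aff (C `&` C') q by rewrite eC; apply: affE => //; exact: sub_aff.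
  move=> /(@aff_dot_eq _ a1 b1) qb1.
  suff : (C `&` C') q by case.
  by rewrite e1; split=> //=; apply: qb1 => z; rewrite e1 => -[].
have [f1 f2] := Sface _ _ S1 S2.
have [q1 [Cq1 Pq1 q1b]] : exists q, [/\ C1 q, P q & dot a q < b].
  by apply: (offH C1 C2) => // /(m1 _ S2) e; apply: neC.
have [q2 [Cq2 Pq2 q2b]] : exists q, [/\ C2 q, P q & dot a q < b].
  apply: (offH C2 C1) => //; first by rewrite setIC.
    by rewrite setIC.
  by move=> /(m2 _ S1).
(* Chosen so that [q2 - al *: (q1 - y0)] lies on the hyperplane; positive because [q1] and [q2] are
   on the same side. *)
pose al := (dot a q2 - b) / (dot a q1 - b).
have al0 : 0 < al by rewrite /al ltr_ndivlMr ?mul0r ?subr_lt0.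
have : aff (C1 `&` C2) (q2 - al *: (q1 - y0)).
  apply: affE.
    have [k [p [c [Ap c1 y0E]]]] := Py0.
    pose pp (s : 'I_1 + ('I_1 + 'I_k)) : V :=
      match s with inl _ => q2 | inr (inl _) => q1 | inr (inr i) => p i end.
    pose cc (s : 'I_1 + ('I_1 + 'I_k)) : R :=
      match s with inl _ => 1 | inr (inl _) => - al | inr (inr i) => al * c i end.
    have -> : q2 - al *: (q1 - y0) = \sum_s cc s *: pp s.
      rewrite !big_sumType /= !big_ord1 y0E scale1r scalerBr opprB scaleNr.
      congr (_ + _); rewrite addrC scaler_sumr; congr (_ + _).
      by apply: eq_bigr => i _; rewrite scalerA.
    apply: aff_fin; first by case=> [i|[i|i]] _ /=; [exact: Pq2|exact: Pq1|exact: Ap].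
    by rewrite !big_sumType /= !big_ord1 -big_distrr /= c1 mulr1 addNr addr0.
  by rewrite dotBr dotZr dotBr y0b /al divfK ?subKr // subr_eq0 lt_eqF.
move=> [k [p [c [Cp c1 zE]]]].
have [l [p' [c' [Cp' c1' y0E]]]] := affE _ Py0 y0b.
(* The affine coefficients [c] and [c'] may be negative. Adding multiples [|c i|] and [al * |c' i|]
   of the points to both sides of the relation makes all weights nonnegative; divided by [W], it
   names one point of both cones. *)
pose p1 (q : V) (s : 'I_1 + ('I_k + 'I_l)) : V :=
  match s with inl _ => q | inr (inl i) => p i | inr (inr i) => p' i end.
pose w1 : 'I_1 + ('I_k + 'I_l) -> R := fun s =>
  match s with inl _ => al | inr (inl i) => `|c i| + c i
    | inr (inr i) => al * (`|c' i| - c' i) end.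
pose w2 : 'I_1 + ('I_k + 'I_l) -> R := fun s =>
  match s with inl _ => 1 | inr (inl i) => `|c i| | inr (inr i) => al * `|c' i| end.
have eqp : \sum_s w1 s *: p1 q1 s = \sum_s w2 s *: p1 q2 s.
  rewrite !big_sumType /= !big_ord1 scale1r.
  have -> : q2 = \sum_i c i *: p i + al *: (q1 - y0) by rewrite -zE subrK.
  have -> : \sum_i (`|c i| + c i) *: p i = \sum_i `|c i| *: p i + \sum_i c i *: p i.
    by rewrite -big_split; apply: eq_bigr => i _; rewrite scalerDl.
  have -> : \sum_i (al * (`|c' i| - c' i)) *: p' i =
      \sum_i (al * `|c' i|) *: p' i - al *: y0.
    rewrite y0E scaler_sumr -sumrB; apply: eq_bigr => i _.
    by rewrite scalerA -scalerBl mulrBr.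
  rewrite scalerBr; apply/rowP => i; rewrite !mxE; ring.
have eqw : \sum_s w1 s = \sum_s w2 s.
  rewrite !big_sumType /= !big_ord1 big_split /= c1 -!big_distrr /= sumrB c1'.
  ring.
pose W := \sum_s w2 s.
have W0 : 0 < W.
  rewrite /W !big_sumType /= !big_ord1 ltr_pwDl ?addr_ge0 ?sumr_ge0 // => i _.
  by rewrite mulr_ge0 // ltW.
have conv1 w q C : (forall s, 0 <= w s) -> \sum_s w s = W -> S C ->
    C q -> (forall s, C (p1 q s)) -> C (W^-1 *: \sum_s w s *: p1 q s).
  move=> w0 wW SC Cq Cpq; have [A _ CA] := Spol _ SC.
  rewrite CA; apply: conv_conv; rewrite -CA scaler_sumr.
  under eq_bigr do rewrite scalerA.
  apply: conv_fin => // [s|]; first by rewrite mulr_ge0 // invr_ge0 ltW.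
  by rewrite -big_distrr /= wW mulVf // gt_eqF.
pose z := W^-1 *: \sum_s w1 s *: p1 q1 s.
have C1z : C1 z.
  apply: conv1 => //.
  - case=> [_|[i|i]] /=; first exact: ltW.
      by rewrite -lerBlDr sub0r ler_normr lexx orbT.
    by rewrite mulr_ge0 ?(ltW al0) // subr_ge0 ler_norm.
  - by case=> [_|[i|i]] //=; [case: (Cp i)|case: (Cp' i)].
have C2z : C2 z.
  rewrite /z eqp; apply: conv1 => //.
  - by case=> [_|[i|i]] //=; rewrite mulr_ge0 // ltW.
  - by case=> [_|[i|i]] //=; [case: (Cp i)|case: (Cp' i)].
(* As a point of both cells [z] lies on the hyperplane, yet [q1] has positive weight [al] in it and
   pulls it strictly below. *)
have : dot a z = b.
  have Pz := SsubP _ S1 _ C1z.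
  apply/Hab; first exact: sub_aff.
  have : aff (C1 `&` C2) z by apply: sub_aff.
  by rewrite affC => -[].
apply/eqP; rewrite lt_eqF //.
have C12b x : (C1 `&` C2) x -> dot a x <= b.
  by move=> [/(SsubP _ S1)/Pab].
rewrite /z dotZr dot_sumr mulrC ltr_pdivrMr //.
have -> : b * W = \sum_s w1 s * b by rewrite -big_distrl /= eqw mulrC.
rewrite !big_sumType /= !big_ord1 ltr_leD //.
  by rewrite ltr_pM2l.
apply: lerD; apply: ler_sum => i _; apply: ler_wpM2l; rewrite ?C12b //.
  by rewrite -lerBlDr sub0r ler_normr lexx orbT.
by rewrite mulr_ge0 ?(ltW al0) // subr_ge0 ler_norm.
Qed.

End Convexity.

(** * Splits of the hypersimplex *)

Lemma small_step (R : realType) (J : finType) (u v : J -> R) :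
  (forall j, 0 < u j) ->
  exists2 e, 0 < e & forall t, `|t| <= e -> forall j, 0 <= u j + t * v j.
Proof.
(* [1 + S] bounds every ratio [|v j| / u j], and the 1 keeps it positive when all [v j] vanish. *)
move=> u0; pose S := \sum_j `|v j| / u j.
have S0 : 0 <= S by apply: sumr_ge0 => j _; rewrite divr_ge0 // ltW.
have S1 : 0 < 1 + S by rewrite ltr_pwDl.
exists (1 + S)^-1; first by rewrite invr_gt0.
move=> t te j; have vS : `|v j| <= u j * (1 + S).
  rewrite -ler_pdivrMl // mulrC /S (bigD1 j) //= addrCA lerDl addr_ge0 //.
  by apply: sumr_ge0 => k _; rewrite divr_ge0 // ltW.
rewrite -lerBlDl sub0r; suff : `|t * v j| <= u j.
  by rewrite ler_norml => /andP[].
rewrite normrM; apply: le_trans (ler_wpM2r (normr_ge0 _) te) _.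
by rewrite ler_pdivrMl // mulrC.
Qed.

(** * Polyhedra with prescribed tight constraints, and their faces *)

Section Polyhedra.
Context (R : realType) (n : nat) (I : finType).
Local Notation V := 'rV[R]_n.
Variables (l : I -> V) (b : I -> R).
Implicit Types (x y : V) (K : {set I}) (A Q : set V).

Definition polyhedron K : set V :=
  [set x : V | (forall k, dot (l k) x <= b k) /\
               (forall k, k \in K -> dot (l k) x = b k)].

Lemma polyhedronI K K' : polyhedron K `&` polyhedron K' = polyhedron (K :|: K').
Proof.
apply/seteqP; split=> x /= [].
  move=> [le eK] [_ eK']; split=> // k; rewrite inE => /orP[]; [exact: eK|exact: eK'].
by move=> le e; do 2!split=> //; move=> k kK; apply: e; rewrite inE kK ?orbT.
Qed.

Lemma face_polyhedronS K K' : K \subset K' -> face (polyhedron K) (polyhedron K').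
Proof.
move=> sK; exists (\sum_(k in K') l k), (\sum_(k in K') b k); split.
  by move=> x [le _]; rewrite dot_suml ler_sum.
apply/seteqP; split=> x /=.
  move=> [le e]; split; first by split=> // k kK; rewrite e // (fintype.subsetP sK).
  by rewrite dot_suml; apply: eq_bigr.
move=> [[le _] e]; split=> // k kK'; apply/eqP; rewrite eq_sym -subr_eq0.
have : \sum_(k in K') (b k - dot (l k) x) == 0 by rewrite sumrB -dot_suml e subrr.
by rewrite psumr_eq0 => [/allP/(_ k (mem_index_enum k))|j _]; rewrite ?kK' ?subr_ge0.
Qed.

(* [K'] consists of the constraints that are tight on the whole face, that is,
   at a point of the face with as few tight constraints as possible. *)
Lemma face_polyhedron K Q : face (polyhedron K) Q ->
  Q = set0 \/ exists2 K' : {set I}, K \subset K' & Q = polyhedron K'.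
Proof.
move=> [a [c [le QE]]].
have [->|/set0P[x1 Qx1]] := eqVneq Q set0; first by left.
right; pose tight x := [set k | dot (l k) x == b k]%SET.
pose hasQ m := `[< exists2 x, Q x & #|tight x| = m >].
have exQ : exists m, hasQ m by exists #|tight x1|; apply/asboolP; exists x1.
case: (ex_minnP exQ) => m /asboolP[x Qx tx] minm.
have [Px ax] : polyhedron K x /\ dot a x = c by move: Qx; rewrite QE => -[].
exists (tight x); first by apply/fintype.subsetP => k kK; rewrite inE Px.2.
apply/seteqP; split=> y /=.
  move=> Qy; have [Py ay] : polyhedron K y /\ dot a y = c by move: Qy; rewrite QE => -[].
  split=> [|k ktx]; first exact: Py.1.
  (* A constraint tight at the midpoint is tight at both ends, so minimality of [tight x] makes
     every constraint tight at [x] tight at [y]. *)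
  pose z := 2^-1 *: (x + y).
  have zE (h : V) : dot h z = (dot h x + dot h y) / 2.
    by rewrite dotZr dotDr mulrC.
  have Qz : Q z.
    rewrite QE; split; last by rewrite /= zE ax ay; field.
    split=> j; rewrite zE; first by have := Px.1 j; have := Py.1 j; lra.
    by move=> jK; rewrite Px.2 // Py.2 //; field.
  have : (m <= #|tight z|)%N by apply: minm; apply/asboolP; exists z.
  have tz : {subset tight z <= tight x :&: tight y}.
    move=> j; rewrite !inE zE => /eqP e; have := Px.1 j; have := Py.1 j.
    by move=> h1 h2; apply/andP; split; apply/eqP; lra.
  have tzx : tight z \subset tight x by apply/fintype.subsetP => j /tz; rewrite inE => /andP[].
  move=> mz; have e : tight z = tight x by apply/eqP; rewrite eqEcard tzx tx.
  by move: ktx; rewrite -e => /tz; rewrite !inE => /andP[_ /eqP].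
move=> [ley ey]; rewrite QE.
have Py : polyhedron K y.
  by split=> // k kK; apply: ey; rewrite inE Px.2.
split=> //=; apply/eqP; rewrite eq_le le //=.
(* If [dot a y < c], a short step from [x] away from [y] would exceed the maximum [c]: constraints
   tight at [x] are tight at [y] and remain so, and the others have slack. The values 1 and 0 on
   tight constraints are dummies. *)
pose u k := if k \in tight x then 1 else b k - dot (l k) x.
pose v k := if k \in tight x then 0 else - dot (l k) (x - y).
have [|e e0 He] := @small_step _ _ u v.
  move=> k; rewrite /u; case: ifPn => //; rewrite inE => nt.
  by rewrite subr_gt0 lt_neqAle nt Px.1.
have /le : polyhedron K (x + e *: (x - y)).
  have tE k : k \in tight x -> dot (l k) (x + e *: (x - y)) = b k.
    move=> kt; rewrite dotDr dotZr dotBr ey //; move: kt; rewrite inE => /eqP ->.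
    by rewrite subrr mulr0 addr0.
  split=> k; last by move=> kK; apply: tE; rewrite inE Px.2.
  have [kt|nt] := boolP (k \in tight x); first by rewrite tE.
  have := He e _ k; rewrite /u /v (negPf nt) ger0_norm ?(ltW e0) //.
  by move=> /(_ (lexx _)); rewrite (dotDr (l k) x (e *: (x - y))) dotZr; lra.
by rewrite dotDr dotZr dotBr ax gerDl pmulr_rle0 // subr_le0.
Qed.

Lemma polyhedron_conv A K : A `<=` polyhedron K -> conv A `<=` polyhedron K.
Proof.
move=> AK x Ax; split=> k; first by apply: (conv_dot_le _ Ax) => y /AK [].
by move=> kK; apply: (aff_dot_eq _ (conv_sub_aff Ax)) => y /AK [_]; exact.
Qed.

End Polyhedra.

Section Faces.
Context (R : realType) (n : nat).
Local Notation V := 'rV[R]_n.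

Lemma face_set0 (P : set V) : face P set0.
Proof.
exists 0, 1; split=> [x _|]; first by rewrite dot0l.
by apply/esym/seteqP; split=> x //= [_]; rewrite dot0l => /esym/eqP; rewrite oner_eq0.
Qed.

Lemma conv_neq0 (A : set V) x : conv A x -> exists y, A y.
Proof.
move=> [[|k] [p [c [Ap _ c1 _]]]]; last by exists (p ord0).
by move: c1; rewrite big_ord0 => /esym/eqP; rewrite oner_eq0.
Qed.

Lemma aff_subset (A B : set V) : A `<=` B -> aff A `<=` aff B.
Proof. by move=> AB x [k [p [c [Ap c1 ->]]]]; exists k, p, c; split=> // i; apply: AB. Qed.

Lemma interior_move (x v : V) : (forall i, 0 < x 0 i < 1) ->
  exists2 e, 0 < e & forall t, `|t| <= e -> cube (x + t *: v).
Proof.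
move=> x01.
have [|e e0 He] := @small_step R ('I_n * bool)%type
    (fun k => if k.2 then x 0 k.1 else 1 - x 0 k.1)
    (fun k => if k.2 then v 0 k.1 else - v 0 k.1).
  by move=> [i s] /=; have /andP[] := x01 i; case: s; rewrite ?subr_gt0.
exists e => // t te i; have := He t te (i, true); have := He t te (i, false).
by rewrite /= !mxE => h1 h2; apply/andP; split; lra.
Qed.

End Faces.

(** * The two halves of a hypersimplex and their faces *)

Section HypersimplexSplit.
Context (R : realType) (n d r : nat) (F : {set 'I_n}).
Local Notation V := 'rV[R]_n.
Local Notation I := (('I_n * bool) + option bool)%type.
Local Notation setN := [set: 'I_n]%SET.
Local Notation sum F x := (dot (charvec R F) x).
Implicit Types (x y v : V) (K : {set I}) (s e : bool) (G : {set 'I_n}).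

Definition sg s : R := if s then 1 else -1.

(** With [cell_bound], the constraints as upper bounds: [inl (i, e)] is [x_i <= 1] or [x_i >= 0],
    [inr (Some e)] is one half of the equation for the coordinate sum, and [inr None] selects the
    side of [sum F x = r], with [<=] for [s = true]. *)
Definition cell_form s (k : I) : V :=
  match k with
  | inl (i, e) => sg e *: delta_mx 0 i
  | inr (Some e) => sg e *: charvec R [set: 'I_n]%SET
  | inr None => sg s *: charvec R F
  end.

Definition cell_bound s (k : I) : R :=
  match k with
  | inl (i, e) => e%:R
  | inr (Some e) => sg e * d%:R
  | inr None => sg s * r%:R
  end.

Definition cell s K := polyhedron (cell_form s) (cell_bound s) K.

Lemma sg_inj s t u : sg s * t = sg s * u -> t = u.
Proof. by case: s; rewrite /sg ?mul1r ?mulN1r // => /oppr_inj. Qed.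

Lemma cellP s K x : cell s K x <->
  [/\ forall i, 0 <= x 0 i <= 1, sum setN x = d%:R, sg s * sum F x <= sg s * r%:R,
      forall i e, inl (i, e) \in K -> x 0 i = e%:R
    & inr None \in K -> sum F x = r%:R].
Proof.
split=> [[le eK]|[x01 xd xF xK FK]].
  have leE i e := le (inl (i, e)); have eKE i e := eK (inl (i, e)).
  split.
  - move=> i; have := leE i true; have := leE i false.
    rewrite /= !dotZl dot_delta /sg => h1 h2; apply/andP; split; lra.
  - have := le (inr (Some true)); have := le (inr (Some false)).
    by rewrite /= !dotZl /sg; lra.
  - by have := le (inr None); rewrite /= dotZl.
  - move=> i e /eKE; rewrite /= dotZl dot_delta /sg.
    by case: e; rewrite ?mul1r // mulN1r => /eqP; rewrite oppr_eq0 => /eqP.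
  - by move=> /eK; rewrite /= dotZl => /sg_inj.
split=> [[[i e]|[e|]]|[[i e]|[e|]]] /=; rewrite !dotZl ?dot_delta ?xd //.
- by have /andP[] := x01 i; case: e; rewrite /sg /=; lra.
- by move=> /xK ->; case: e; rewrite /sg ?mul1r ?mulr0.
- by move=> /FK ->.
Qed.

Lemma cell_hypersimplex s x : cell s finset.set0 x <->
  hypersimplex d x /\ sg s * sum F x <= sg s * r%:R.
Proof.
have sum_coord : sum setN x = \sum_i x 0 i.
  by rewrite dot_charvec; apply: eq_bigl => i; rewrite inE.
split=> [/cellP[x01 xd xF _ _]|[[x01 xd] xF]].
  by do 2!split=> //; rewrite /= -sum_coord.
apply/cellP; split=> //; last 2 first.
- by move=> i e; rewrite inE.
- by rewrite inE.
- by rewrite sum_coord.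
Qed.

Lemma cell_swap s K : inr None \in K -> cell s K = cell (~~ s) K.
Proof.
move=> NK; apply/seteqP; split=> x /cellP[? ? _ ? FK];
  by apply/cellP; split=> //; rewrite FK.
Qed.

Lemma cellI s K K' : cell s K `&` cell (~~ s) K' = cell s (inr None |: (K :|: K')).
Proof.
apply/seteqP; split=> x.
  move=> [/cellP[x01 xd le xK FK] /cellP[_ _ le' xK' FK']].
  have eF : sum F x = r%:R by case: s le le' {FK FK'}; rewrite /sg /=; lra.
  apply/cellP; split=> // i e; rewrite !inE /= => /orP[]; [exact: xK|exact: xK'].
move=> xC; split; last rewrite (@cell_swap s) ?setU11 // in xC.
  case/cellP: xC => x01 xd le xK FK; apply/cellP; split=> //.
    by move=> i e iK; apply: xK; rewrite !inE iK.
  by move=> _; apply: FK; rewrite setU11.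
case/cellP: xC => x01 xd le xK FK; apply/cellP; split=> //.
  by move=> i e iK; apply: xK; rewrite !inE iK orbT.
by move=> _; apply: FK; rewrite setU11.
Qed.

Lemma dot_exchange G (i j : 'I_n) :
  sum G (delta_mx 0 i - delta_mx 0 j) = (i \in G)%:R - (j \in G)%:R.
Proof. by rewrite dotBr !(dotC _ (delta_mx _ _)) !dot_delta !mxE. Qed.

Definition frac x := [set i | 0 < x 0 i < 1]%SET.

Lemma sum_nonfrac G x : (forall i, 0 <= x 0 i <= 1) -> {in G, forall i, i \notin frac x} ->
  exists m : nat, sum G x = m%:R.
Proof.
move=> x01 dG; exists #|[set i in G | x 0 i == 1]|.
rewrite dot_charvec -sum1_card natr_sum big_mkcond [RHS]big_mkcond /=.
apply: eq_bigr => i _; rewrite inE; case: ifP => //= iG.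
have /negbTE := dG _ iG; rewrite inE; have /andP[] := x01 i.
rewrite le_eqVlt => /orP[/eqP <-|-> /=]; first by rewrite eq_sym oner_eq0.
by rewrite le_eqVlt => /orP[/eqP ->|->]; rewrite ?eqxx.
Qed.

Lemma sum_frac1 G x i : (forall i, 0 <= x 0 i <= 1) -> i \in G ->
  {in G, forall k, k != i -> k \notin frac x} ->
  exists m : nat, sum G x = m%:R + x 0 i.
Proof.
move=> x01 iG Gi; have [|m em] := @sum_nonfrac (G :\ i) x x01.
  by move=> k; rewrite in_setD1 => /andP[ki kG]; exact: Gi.
exists m; rewrite -em !dot_charvec (bigD1 i) //= addrC; congr (_ + _).
by apply: eq_bigl => k; rewrite in_setD1 andbC.
Qed.

Lemma exchange_frac x i j t : i != j -> i \in frac x -> j \in frac x ->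
  (forall k, 0 <= x 0 k <= 1) -> 0 <= x 0 i + t <= 1 -> 0 <= x 0 j - t <= 1 ->
  let y := x + t *: (delta_mx 0 i - delta_mx 0 j) in
  [/\ forall k, 0 <= y 0 k <= 1, forall k, k != i -> k != j -> y 0 k = x 0 k,
      y 0 i = x 0 i + t & y 0 j = x 0 j - t].
Proof.
move=> ij ifr jfr x01 it jt y.
have yi : y 0 i = x 0 i + t.
  by rewrite !mxE !eqxx (negPf ij) subr0 mulr1.
have yj : y 0 j = x 0 j - t.
  by rewrite !mxE !eqxx eq_sym (negPf ij) sub0r mulrN1.
have yk k : k != i -> k != j -> y 0 k = x 0 k.
  by move=> ki kj; rewrite !mxE !eqxx (negPf ki) (negPf kj) subr0 mulr0 addr0.
split=> // k; have [->|ki] := eqVneq k i; first by rewrite yi.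
by have [->|kj] := eqVneq k j; rewrite ?yj ?yk.
Qed.

(** Cells have only 0/1 vertices. A point is pushed both ways along [e_i - e_j], for two fractional
    coordinates, until one of them becomes integral; it lies between the two results. If [i] and [j]
    are both in [F] or both outside, [sum F x] does not change. *)
Lemma cell_conv s K x : cell s K x ->
  conv [set y : V | cell s K y /\ exists B, y = charvec R B] x.
Proof.
set A := (X in conv X).
have [m] := ubnP #|frac x|; elim: m x => // m IH x; rewrite ltnS => lem xC.
have [x01 xd xF xK FK] := (cellP s K x).1 xC.
have [fx0|/set0Pn[i0 i0f]] := eqVneq (frac x) finset.set0.
  apply: sub_conv; split=> //; exists [set i | x 0 i == 1]%SET.
  apply/rowP => i; rewrite mxE inE; have := finset.in_set0 i; rewrite -fx0 inE.
  have /andP[] := x01 i.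
  rewrite le_eqVlt => /orP[/eqP <-|-> /=]; first by rewrite eq_sym oner_eq0.
  by rewrite le_eqVlt => /orP[/eqP ->|->]; rewrite ?eqxx.
pose y i j t := x + t *: (delta_mx 0 i - delta_mx 0 j).
have step i j : i != j -> i \in frac x -> j \in frac x ->
    (forall t, 0 <= x 0 i + t <= 1 -> 0 <= x 0 j - t <= 1 ->
       sg s * sum F (y i j t) <= sg s * r%:R /\
       (inr None \in K -> sum F (y i j t) = r%:R)) -> conv A x.
  move=> ij ifr jfr Hside.
  have /andP[xi0 xi1] : 0 < x 0 i < 1 by move: ifr; rewrite inE.
  have /andP[xj0 xj1] : 0 < x 0 j < 1 by move: jfr; rewrite inE.
  have yA t : 0 <= x 0 i + t <= 1 -> 0 <= x 0 j - t <= 1 ->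
      (x 0 i + t == 0) || (x 0 i + t == 1) || (x 0 j - t == 0) || (x 0 j - t == 1) ->
      conv A (y i j t).
    move=> it jt ends; have [y01 yk yi yj] := exchange_frac ij ifr jfr x01 it jt.
    have [yF yFK] := Hside t it jt; apply: IH; last first.
      apply/cellP; split=> //; first by rewrite dotDr dotZr dot_exchange !inE subrr mulr0 addr0.
      move=> k e kK; have xk := xK _ _ kK.
      have ki : k != i by apply/eqP => ki; move: xk; rewrite ki; case: (e) => /=; lra.
      have kj : k != j by apply/eqP => kj; move: xk; rewrite kj; case: (e) => /=; lra.
      by rewrite yk.
    apply: leq_trans lem; apply: proper_card; apply/properP; split.
      apply/fintype.subsetP => k; have [->|ki] := eqVneq k i; first by [].
      by have [->|kj] := eqVneq k j; rewrite // !inE yk.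
    have [ei|ei] := boolP ((x 0 i + t == 0) || (x 0 i + t == 1)).
      by exists i; rewrite // inE yi; case/orP: ei => /eqP ->; rewrite ltxx ?andbF.
    move: ends; rewrite (negPf ei) /= => ej.
    by exists j; rewrite // inE yj; case/orP: ej => /eqP ->; rewrite ltxx ?andbF.
  pose t1 : R := Num.min (1 - x 0 i) (x 0 j); pose t2 : R := Num.min (x 0 i) (1 - x 0 j).
  have [t10 Y1] : 0 < t1 /\ conv A (y i j t1).
    rewrite /t1; case: (leP (1 - x 0 i) (x 0 j)) => h; split; try lra.
      apply: yA; [apply/andP; split; lra|apply/andP; split; lra|].
      by rewrite addrC subrK eqxx !orbT.
    apply: yA; [apply/andP; split; lra|apply/andP; split; lra|].
    by rewrite subrr eqxx !orbT.
  have [t20 Y2] : 0 < t2 /\ conv A (y i j (- t2)).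
    rewrite /t2; case: (leP (x 0 i) (1 - x 0 j)) => h; split; try lra.
      apply: yA; [apply/andP; split; lra|apply/andP; split; lra|].
      by rewrite subrr eqxx.
    apply: yA; [apply/andP; split; lra|apply/andP; split; lra|].
    have -> : x 0 j - - (1 - x 0 j) = 1 by ring.
    by rewrite eqxx !orbT.
  have -> : x = (t2 / (t1 + t2)) *: y i j t1 + (1 - t2 / (t1 + t2)) *: y i j (- t2).
    by apply/rowP => k; rewrite !mxE; field; rewrite gt_eqF // addr_gt0.
  have lam0 : 0 < t2 / (t1 + t2) by rewrite divr_gt0 // addr_gt0.
  apply: conv2 => //; rewrite (ltW lam0) /=.
  by rewrite ler_pdivrMr ?addr_gt0 // mul1r lerDr ltW.
have same i j : i != j -> i \in frac x -> j \in frac x ->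
    (i \in F) = (j \in F) -> conv A x.
  move=> ij ifr jfr eF; apply: (step i j) => // t _ _.
  by rewrite dotDr dotZr dot_exchange eF subrr mulr0 addr0.
(* Here [sum F x] is an integer plus the fractional [x 0 i], so it differs from the integer [r] and
   cannot cross it before [x 0 i] reaches 0 or 1. *)
have mixed i j : i \in frac x -> j \in frac x -> i \in F -> j \notin F ->
    (forall k, k \in F -> k != i -> k \notin frac x) -> conv A x.
  move=> ifr jfr iF jF Fi.
  have ij : i != j by apply: contraNneq jF => <-.
  have [q eq] := sum_frac1 x01 iF Fi.
  apply: (step i j) => // t it jt.
  rewrite dotDr dotZr dot_exchange iF (negPf jF) subr0 mulr1 eq.
  have /andP[xi0 xi1] : 0 < x 0 i < 1 by move: ifr; rewrite inE.
  case/andP: it => it0 it1.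
  split; last first.
    move=> /FK; rewrite eq => e; exfalso.
    have : (q%:R : R) < r%:R by lra.
    have : r%:R < (q.+1%:R : R) by rewrite -natr1; lra.
    by rewrite !ltr_nat; clear; lia.
  move: xF; rewrite eq; case: s {IH xC step same A} => /=; rewrite /sg ?mul1r ?mulN1r.
    move=> h; have : (q%:R : R) < r%:R by lra.
    by rewrite ltr_nat -(ler_nat R) -natr1; lra.
  move=> h; have : r%:R < (q.+1%:R : R) by rewrite -natr1; lra.
  by rewrite ltr_nat ltnS -(ler_nat R); lra.
have [/existsP[j /and3P[ji jf /eqP eF]]|noi] :=
    boolP [exists j, [&& j != i0, j \in frac x & (j \in F) == (i0 \in F)]].
  exact: (same j i0).
have unique i : ~~ [exists j, [&& j != i, j \in frac x & (j \in F) == (i \in F)]] ->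
    forall k, (k \in F) = (i \in F) -> k != i -> k \notin frac x.
  move=> /existsPn no k ekF ki; apply: contraT => /negPn kf.
  by have := no k; rewrite ki kf ekF eqxx.
(* A single fractional coordinate would make the coordinate sum [d] non-integral. *)
have [j0 j0f j0i] : exists2 j, j \in frac x & j != i0.
  apply/exists_inP; apply: contraT => /exists_inPn no.
  have [|q eq] := @sum_frac1 setN x i0 x01 (finset.in_setT i0).
    by move=> k _ ki; apply: contraT => /negPn kf; have := no k kf; rewrite ki.
  move: i0f; rewrite inE; move: eq; rewrite xd => eq /andP[h0 h1].
  have : (q%:R : R) < d%:R by lra.
  have : d%:R < (q.+1%:R : R) by rewrite -natr1; lra.
  by rewrite !ltr_nat; clear; lia.
have [/existsP[j /and3P[ji jf /eqP eF]]|noj] :=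
    boolP [exists j, [&& j != j0, j \in frac x & (j \in F) == (j0 \in F)]].
  exact: (same j j0).
have [iF|iF] := boolP (i0 \in F); have [jF|jF] := boolP (j0 \in F).
- by apply: (same j0 i0); rewrite // iF jF.
- by apply: (mixed i0 j0) => // k kF; apply: unique => //; rewrite iF kF.
- by apply: (mixed j0 i0) => // k kF; apply: unique => //; rewrite jF kF.
- by apply: (same j0 i0); rewrite // (negPf iF) (negPf jF).
Qed.

(** As [K] runs over all sets of tight constraints, these are all faces of both halves. The empty
    face is listed separately, as in [face_polyhedron]. *)
Definition cells : set (set V) :=
  [set C | C = set0 \/ exists s K, C = cell s K].

Lemma finite_cells : finite_set cells.
Proof.
apply: (@sub_finite_set _ _ (range (fun o : option (bool * {set I}) =>
  if o is Some (s, K) then cell s K else set0))); last exact: finite_image.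
by move=> C [->|[s [K ->]]]; [exists None|exists (Some (s, K))].
Qed.

Lemma cell_polytope s K : polytope (cell s K).
Proof.
exists [set y : V | cell s K y /\ exists B, y = charvec R B].
  apply: (@sub_finite_set _ _ (range (fun B : {set 'I_n} => charvec R B))).
    by move=> y [_ [B ->]]; exists B.
  exact: finite_image.
apply/seteqP; split=> [x|]; first exact: cell_conv.
by apply: polyhedron_conv => y [].
Qed.

Lemma cell_subset s K : cell s K `<=` cell s finset.set0.
Proof. by move=> x [le _]; split=> // k; rewrite inE. Qed.

Lemma face_cellI s s' K K' : face (cell s K) (cell s K `&` cell s' K').
Proof.
have [->|ss'] := eqVneq s' s.
  by rewrite polyhedronI; apply: face_polyhedronS; exact: finset.subsetUl.
have -> : s' = ~~ s by case: s s' ss' => [] [].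
rewrite cellI; apply: face_polyhedronS.
by apply/fintype.subsetP => k kK; rewrite !inE kK orbT.
Qed.

Lemma cells_complex : polytopal_complex cells.
Proof.
split.
- exact: finite_cells.
- move=> C [->|[s [K ->]]]; last exact: cell_polytope.
  exists set0; first exact: finite_set0.
  by apply/seteqP; split=> x // /conv_neq0[].
- move=> C Q [->|[s [K ->]]] fQ.
    by left; case: fQ => a [b [_ ->]]; rewrite set0I.
  have [->|[K' _ ->]] := face_polyhedron fQ; first by left.
  by right; exists s, K'.
move=> C C' [->|[s [K ->]]]; first by rewrite set0I; split; exact: face_set0.
move=> [->|[s' [K' ->]]]; first by rewrite setI0; split; exact: face_set0.
by split; [|rewrite setIC]; exact: face_cellI.
Qed.

Lemma face_hypersimplex_charvec B : hypersimplex d (charvec R B) ->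
  face (hypersimplex d) ([set charvec R B] : set V).
Proof.
move=> [_ /=]; under eq_bigr do rewrite -dot_delta.
rewrite -dot_suml => dB.
have cB : #|B| = d.
  apply/eqP; rewrite -(eqr_nat R) -dB; apply/eqP.
  rewrite dot_suml; under eq_bigr do rewrite dot_delta.
  by rewrite sum_coord dot_charvec2 finset.setTI.
have sumB x : sum setN x = sum B x + sum (~: B)%SET x.
  by rewrite charvecC dotDl dotNl addrCA subrr addr0.
have sumC0 x : cube x -> 0 <= sum (~: B)%SET x.
  by move=> x01; rewrite dot_charvec sumr_ge0 // => i _; case/andP: (x01 i).
exists (charvec R B), d%:R; split.
  by move=> x [x01 /=]; rewrite sum_coord sumB => <-; rewrite lerDl sumC0.
apply/seteqP; split=> [x ->|x /= [[x01 xd] xB]].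
  split; last by rewrite /= dot_charvec2 finset.setIid cB.
  split=> [i|]; last by rewrite /= sum_coord dot_charvec2 finset.setTI cB.
  by rewrite mxE; case: (_ \in _); rewrite ?lexx ?ler01.
have xC : sum (~: B)%SET x == 0.
  by move: xd; rewrite /= sum_coord sumB xB -[X in _ = X]addr0 => /addrI ->.
have xB1 : \sum_(i in B) (1 - x 0 i) == 0.
  by rewrite sumrB sumr_const -dot_charvec xB cB subrr.
apply/rowP => i; rewrite mxE.
have [iB|iB] := boolP (i \in B).
  move: xB1; rewrite psumr_eq0 => [/allP/(_ i (mem_index_enum i))|j _].
    by rewrite iB subr_eq0 => /eqP.
  by rewrite subr_ge0; case/andP: (x01 j).
move: xC; rewrite dot_charvec psumr_eq0 => [/allP/(_ i (mem_index_enum i))|j _].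
  by rewrite inE iB => /eqP.
by case/andP: (x01 j).
Qed.

Lemma cells_subdivision : subdivision (hypersimplex d) cells.
Proof.
split; first exact: cells_complex.
  apply/seteqP; split=> x.
    by move=> [C [->//|[s [K ->]]] /cell_subset/cell_hypersimplex[]].
  move=> xP; have [le|lt] := leP (sum F x) r%:R.
    exists (cell true finset.set0); first by right; exists true, finset.set0.
    by apply/cell_hypersimplex; split=> //; rewrite /sg !mul1r.
  exists (cell false finset.set0); first by right; exists false, finset.set0.
  by apply/cell_hypersimplex; split=> //; rewrite /sg !mulN1r lerN2 ltW.
move=> v [e|[s [K eC]]]; first by have : [set v] v by []; rewrite e.
have vC : cell s K v by rewrite -eC.
(* A one-point cell contains a 0/1 vector, so it is a vertex of the hypersimplex. *)
have [y [yC [B yB]]] := conv_neq0 (cell_conv vC).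
have vB : v = charvec R B by rewrite -yB; move: yC; rewrite -eC => <-.
rewrite vB in vC *; apply: face_hypersimplex_charvec.
by case/cell_subset/cell_hypersimplex: vC.
Qed.

(** The inequalities say that the averages [r / #|F|] on [F] and [(d - r) / #|~: F|] off [F] lie
    strictly between 0 and 1; the resulting [x0] is an interior point on the hyperplane. *)
Lemma hypersimplex_split : (0 < r < d)%N -> (r < #|F|)%N -> (d + #|F| < n + r)%N ->
  defines_split (hypersimplex d) [set x : V |
    (d%:R - r%:R) * (\sum_(i in F) x 0 i) = r%:R * (\sum_(j | j \notin F) x 0 j)].
Proof.
move=> /andP[r0 rd] rF dF.
have cF : (#|F| + #|(~: F)%SET| = n)%N by rewrite cardsC card_ord.
have ltC : (d - r < #|(~: F)%SET|)%N by lia.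
have HE x : sum setN x = d%:R -> (d%:R - r%:R) * (\sum_(i in F) x 0 i) =
    r%:R * (\sum_(j | j \notin F) x 0 j) <-> sum F x = r%:R.
  move=> xd; rewrite sum_coordC -dot_charvec xd.
  have d0 : d%:R != 0 :> R by rewrite pnatr_eq0 -lt0n (leq_trans _ rd).
  by split=> [h|->]; [apply: (mulfI d0)|]; lra.
have [x0 [x01 xd xF]] : exists x : V,
    [/\ forall i, 0 < x 0 i < 1, sum setN x = d%:R & sum F x = r%:R].
  have f0 : (0 : R) < #|F|%:R by rewrite ltr0n; lia.
  have g0 : (0 : R) < #|(~: F)%SET|%:R by rewrite ltr0n; lia.
  pose x : V := r%:R / #|F|%:R *: charvec R F +
                (d - r)%:R / #|(~: F)%SET|%:R *: charvec R (~: F)%SET.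
  have xF : sum F x = r%:R.
    rewrite dotDr !dotZr !dot_charvec2 finset.setIid finset.setICr cards0 mulr0 addr0.
    by rewrite divfK // gt_eqF.
  have xC : sum (~: F)%SET x = (d - r)%:R.
    rewrite dotDr !dotZr !dot_charvec2 finset.setIid (finset.setIC _ F) finset.setICr cards0.
    by rewrite mulr0 add0r divfK // gt_eqF.
  exists x; split=> //; last first.
    by move: xC; rewrite charvecC dotDl dotNl xF natrB ?(ltnW rd) //; lra.
  move=> i; rewrite !mxE inE; case: (i \in F) => /=.
    rewrite mulr1 mulr0 addr0; apply/andP; split; first by rewrite divr_gt0 // ltr0n.
    by rewrite ltr_pdivrMr // mul1r ltr_nat.
  rewrite mulr1 mulr0 add0r; apply/andP; split.
    by rewrite divr_gt0 // ltr0n subn_gt0.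
  by rewrite ltr_pdivrMr // mul1r ltr_nat.
have off s : exists2 x, cell s finset.set0 x & ~ cell (~~ s) finset.set0 x.
  have /card_gt0P[i iF] : (0 < #|F|)%N by lia.
  have /card_gt0P[j] : (0 < #|(~: F)%SET|)%N by lia.
  rewrite inE => jF; have [e e0 He] := interior_move (delta_mx 0 i - delta_mx 0 j) x01.
  pose x := x0 + (- sg s * e) *: (delta_mx 0 i - delta_mx 0 j).
  have sxF : sum F x = r%:R - sg s * e.
    by rewrite dotDr dotZr dot_exchange iF (negPf jF) xF subr0 mulr1 mulNr.
  exists x.
    apply/cell_hypersimplex; split; last first.
      by rewrite sxF; case: s {x sxF}; rewrite /sg; lra.
    split; last by rewrite /= sum_coord dotDr dotZr dot_exchange !inE subrr mulr0 addr0.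
    by apply: He; case: s {x sxF}; rewrite /sg ?mulN1r ?opprK ?mul1r ?normrN gtr0_norm.
  move=> /cell_hypersimplex[_]; rewrite sxF.
  by case: s {x sxF}; rewrite /sg /=; lra.
have cellT s : cells (cell s finset.set0) by right; exists s, finset.set0.
have x0P : hypersimplex d x0.
  split; last by rewrite /= sum_coord.
  by move=> i; have /andP[/ltW -> /ltW ->] := x01 i.
have x0C s : cell s finset.set0 x0 by apply/cell_hypersimplex; rewrite xF.
exists cells, (cell true finset.set0), (cell false finset.set0); split.
- exact: cells_subdivision.
- by have [x xt nxt] := off true; move=> e; apply: nxt; rewrite -e.
- have maxT s : maximal_cell cells (cell s finset.set0).
    split=> // C' [->|[s' [K' ->]]] sub; first by have := sub _ (x0C s).
    have [es|ns] := eqVneq s' s.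
      by apply/seteqP; split=> //; rewrite es; exact: cell_subset.
    have [x xs nxs] := off s; exfalso; apply: nxs.
    have -> : ~~ s = s' by case: s s' ns {sub xs} => [] [].
    exact/cell_subset/sub.
  move=> C; split=> [[]|[] ->] //.
  move=> [->|[s [K ->]]] maxC; first by rewrite -(maxC _ (cellT true)); [left|].
  by rewrite -(maxC _ (cellT s) (@cell_subset s K)); case: s {maxC}; [left|right].
rewrite cellI; set C := cell _ _.
have CE x : C x <-> hypersimplex d x /\ sum F x = r%:R.
  split=> [xC|[xP eF]].
    have [xP _] := (cell_hypersimplex _ _).1 (cell_subset xC).
    by split=> //; have [_ _ _ _] := (cellP _ _ _).1 xC; apply; rewrite setU11.
  have /cellP[h1 h2 h3 _ _] : cell true finset.set0 x.
    by apply/cell_hypersimplex; rewrite eF.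
  by apply/cellP; split=> // i e; rewrite !inE.
apply/seteqP; split=> x.
  move=> xC; split; last by apply: aff_subset xC => y /CE[].
  apply/HE; first by apply: aff_dot_eq xC => y /CE[[_ /=]]; rewrite sum_coord.
  by apply: aff_dot_eq xC => y /CE[].
move=> [/= xH xaff].
have sx : sum setN x = d%:R by apply: aff_dot_eq xaff => y [_ /=]; rewrite sum_coord.
move/(HE _ sx): xH => sxF.
(* A short step from [x0] towards [x] stays in the common cell, and [x] is an affine combination of
   its two ends. *)
have [e e0 He] := interior_move (x - x0) x01.
have C0 : C x0 by apply/CE.
have C1 : C (x0 + e *: (x - x0)).
  apply/CE; split; last by rewrite dotDr dotZr dotBr sxF xF subrr mulr0 addr0.
  split; first by apply: He; rewrite gtr0_norm.
  by rewrite /= sum_coord dotDr dotZr dotBr sx xd subrr mulr0 addr0.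
have -> : x = \sum_(s : bool) (if s then e^-1 else 1 - e^-1) *:
                (if s then x0 + e *: (x - x0) else x0).
  rewrite big_bool /= scalerDr scalerA mulVf ?gt_eqF // scale1r scalerBl scale1r.
  by apply/rowP => i; rewrite !mxE; ring.
apply: aff_fin; first by case.
by rewrite big_bool /= addrC subrK.
Qed.

End HypersimplexSplit.

(** * Flacets of matroid polytopes *)

Section AffineRank.
Context (R : realType) (n : nat).
Local Notation V := 'rV[R]_n.

(** On a hyperplane that misses the origin, the coefficients of a linear relation automatically sum
    to 0, so affine and linear independence agree. *)
Lemma aff_rank_rows (A : set V) N (X : 'M[R]_(N, n)) a b : b != 0 ->
  (forall x, A x -> dot a x = b) -> (forall i, A (row i X)) ->
  (forall x, A x -> (x <= X)%MS) -> aff_rank A (\rank X).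
Proof.
move=> b0 Ab AX AsX.
have mulE k (c : 'I_k -> R) (p : 'I_k -> V) :
    \sum_i c i *: p i = (\row_i c i) *m (\matrix_i p i).
  by rewrite mulmx_sum_row; apply: eq_bigr => i _; rewrite mxE rowK.
split.
  exists (fun i => row (maxrankfun X i) X) => // c c0 e i.
  have /row_freeP[Y XY] := maxrowsub_free X.
  move: e; rewrite mulE.
  have -> : \matrix_i row (maxrankfun X i) X = rowsub (maxrankfun X) X.
    by apply/matrixP => u v; rewrite !mxE.
  move=> /(congr1 (fun Z => Z *m Y)); rewrite -mulmxA XY mulmx1 mul0mx.
  by move=> /rowP/(_ i); rewrite !mxE.
move=> p Ap indep_p; pose Y := \matrix_i p i.
have freeY : row_free Y.
  apply: inj_row_free => u uY.
  have e : \sum_i u 0 i *: p i = 0.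
    by rewrite mulE -[RHS]uY; congr (_ *m _); apply/rowP => i; rewrite mxE.
  apply/rowP => i; rewrite mxE; apply: (indep_p (fun i => u 0 i)) => //.
  have := congr1 (dot a) e; rewrite dot_sumr (dotC _ 0) dot0l.
  under eq_bigr do rewrite Ab //.
  by rewrite -big_distrl /= => /eqP; rewrite mulf_eq0 (negPf b0) orbF => /eqP.
have : (Y <= X)%MS by apply/row_subP => i; rewrite rowK; apply: AsX.
by move/mxrankS; move/eqP: freeY => ->; rewrite ltnn.
Qed.

(** Rank-nullity for an annihilator spanned by [w]: [w = 0] gives full rank, [w] nonzero gives
    corank 1. *)
Lemma mxrank_kertr N (X : 'M[R]_(N, n)) (w : V) :
  (forall a : V, a *m X^T = 0 <-> exists t, a = t *: w) ->
  (\rank X + (w != 0%R) = n)%N.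
Proof.
move=> kerX; have <- : \rank (kermx X^T) = (w != 0).
  rewrite -rank_rV; apply/eqmx_rank; apply/andP; split.
    apply/rV_subP => a /sub_kermxP/kerX[t ->]; exact: scalemx_sub.
  by apply/sub_kermxP/kerX; exists 1; rewrite scale1r.
by rewrite mxrank_ker mxrank_tr subnKC // rank_leq_col.
Qed.

End AffineRank.

Section MatroidPolytope.
Context (R : realType) (n : nat) (M : matroid 'I_n).
Local Notation V := 'rV[R]_n.
Local Notation setN := [set: 'I_n]%SET.
Local Notation sum F x := (dot (charvec R F) x).
Local Notation P := (matroid_polytope (R := R) M).
Implicit Types (F G B : {set 'I_n}) (x y a : V).

Definition face_bases F := [set B in bases M | #|F :&: B| == rk M F]%SET.

Definition face_mx F : 'M[R]_(#|face_bases F|, n) :=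
  \matrix_k charvec R (enum_val k).

Lemma polytope_basis B : B \in bases M -> P (charvec R B).
Proof. by move=> Bb; apply: sub_conv; exists B. Qed.

Lemma polytope_sum x : P x -> sum setN x = (rank M)%:R.
Proof.
move/conv_sub_aff; apply: aff_dot_eq => y [B Bb ->].
by rewrite dot_charvec2 finset.setTI (basis_rank Bb).
Qed.

Lemma polytope_le F x : P x -> sum F x <= (rk M F)%:R.
Proof.
apply: conv_dot_le => y [B Bb ->].
by rewrite dot_charvec2 ler_nat leq_rk.
Qed.

Lemma flat_faceE F x : flat_face M F x <-> P x /\ sum F x = (rk M F)%:R.
Proof. by split=> -[Px e]; split=> //; move: e; rewrite /= dot_charvec. Qed.

Lemma flat_face_basis F B : B \in face_bases F -> flat_face M F (charvec R B).
Proof.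
rewrite inE => /andP[Bb /eqP FB]; apply/flat_faceE; split.
  exact: polytope_basis.
by rewrite dot_charvec2 FB.
Qed.

(** The gaps between [rk M F] and [sum F (p i)] are nonnegative with weighted sum 0, so only bases
    of the face carry weight. *)
Lemma flat_face_face_mx F x : flat_face M F x -> (x <= face_mx F)%MS.
Proof.
move/flat_faceE => [[k [p [c [Bp c0 c1 xE]]]] xF].
have gap i : 0 <= c i * ((rk M F)%:R - sum F (p i)).
  by rewrite mulr_ge0 // subr_ge0 polytope_le //; apply: sub_conv.
have : \sum_i c i * ((rk M F)%:R - sum F (p i)) == 0.
  under eq_bigr do rewrite mulrBr.
  by rewrite sumrB -big_distrl /= c1 mul1r -dot_sumr -xE xF subrr.
rewrite psumr_eq0 // => /allP e0; rewrite xE; apply: summx_sub => i _.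
have := e0 i (mem_index_enum i); rewrite /= mulf_eq0 => /orP[/eqP ->|].
  by rewrite scale0r sub0mx.
have [B Bb pB] := Bp i; rewrite pB subr_eq0 dot_charvec2 eqr_nat eq_sym => FB.
have BF : B \in face_bases F by rewrite inE Bb.
apply: scalemx_sub; have -> : charvec R B = row (enum_rank_in BF B) (face_mx F).
  by rewrite rowK enum_rankK_in.
exact: row_sub.
Qed.

Lemma face_mx_ker F a : a *m (face_mx F)^T = 0 <->
  (forall B, B \in face_bases F -> dot a (charvec R B) = 0).
Proof.
have E k : (a *m (face_mx F)^T) 0 k = dot a (charvec R (enum_val k)).
  by rewrite mxE; apply: eq_bigr => i _; rewrite !mxE.
split=> [e B BF|e]; last first.
  by apply/rowP => k; rewrite E mxE; apply: e; exact: enum_valP.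
have := E (enum_rank_in BF B); rewrite e mxE enum_rankK_in //.
Qed.

Lemma charvec_exchange B i j : i \notin B -> j \in B ->
  charvec R (i |: (B :\ j))%SET = charvec R B + delta_mx 0 i - delta_mx 0 j.
Proof.
move=> iB jB; apply/rowP => k; rewrite !mxE !inE /=.
have [->|ki] := eqVneq k i.
  have -> : (i == j) = false by apply: contraNF iB => /eqP ->.
  by rewrite (negPf iB) add0r subr0.
have [->|kj] := eqVneq k j; first by rewrite jB /= addr0 subrr.
by rewrite /= addr0 subr0.
Qed.

(** Bases of the face that differ by an exchange have characteristic vectors differing by
    [e_i - e_j], on which the form vanishes. *)
Lemma face_const F a : a *m (face_mx F)^T = 0 ->
  (rconnected M F -> {in F &, forall i j, a 0 i = a 0 j}) /\
  (cconnected M F -> {in [predC F] &, forall i j, a 0 i = a 0 j}).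
Proof.
move/face_mx_ker => aF.
have ex B i j : B \in bases M -> #|F :&: B|%SET = rk M F -> i \notin B -> j \in B ->
    (i |: (B :\ j))%SET \in bases M ->
    #|F :&: (i |: (B :\ j))|%SET = rk M F -> a 0 i = a 0 j.
  move=> Bb FB iB jB B'b FB'.
  have := aF (i |: (B :\ j))%SET; rewrite inE B'b FB' eqxx => /(_ isT).
  rewrite charvec_exchange // dotBr dotDr aF ?inE ?Bb ?FB ?eqxx // add0r.
  by rewrite !(dotC a) !dot_delta => /eqP; rewrite subr_eq0 => /eqP.
by split=> c; [exact: (rconnected_const (a := fun i => a 0 i) ex)
              |exact: (cconnected_const (a := fun i => a 0 i) ex)].
Qed.

Hypothesis conM : rconnected M setN.
Hypothesis rank_gt0 : (0 < rank M)%N.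

Let rank_neq0 : (rank M)%:R != 0 :> R.
Proof. by rewrite pnatr_eq0 -lt0n. Qed.

(** As [M] is connected, a form vanishing on all bases is constant, and its value on a basis is
    [rank M] times the constant. *)
Lemma face_mxT_full : row_full (face_mx setN).
Proof.
have /mxrank_kertr : forall a : V, a *m (face_mx setN)^T = 0 <-> exists t, a = t *: (0 : V).
  move=> a; split=> [e|[t ->]]; last by rewrite scaler0 mul0mx.
  exists 0; rewrite scaler0.
  have ca := (face_const e).1 conM.
  have [B Bb] := bases_nonempty M.
  have := (face_mx_ker _ _).1 e B; rewrite inE Bb finset.setTI (basis_rank Bb) eqxx.
  move=> /(_ isT) eB; apply/rowP => i; rewrite [RHS]mxE.
  have ai : a = a 0 i *: charvec R setN.
    by apply/rowP => j; rewrite !mxE inE mulr1; apply: ca; rewrite inE.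
  move: eB; rewrite {1}ai dotZl dot_charvec2 finset.setTI (basis_rank Bb).
  by move/eqP; rewrite mulf_eq0 (negPf rank_neq0) orbF => /eqP.
by rewrite eqxx addn0 => e; rewrite /row_full e.
Qed.

Lemma aff_polytope x : sum setN x = (rank M)%:R -> aff P x.
Proof.
move=> xd; have /submxP[u xE] := submx_full x face_mxT_full.
have xE' : x = \sum_k u 0 k *: charvec R (enum_val k).
  by rewrite xE mulmx_sum_row; apply: eq_bigr => k _; rewrite rowK.
have rb (k : 'I_#|face_bases setN|) : enum_val k \in bases M.
  by have := enum_valP k; rewrite inE => /andP[].
rewrite xE'; apply: aff_fin => [k _|]; first exact: polytope_basis.
move: xd; rewrite xE' dot_sumr.
under eq_bigr => k _ do rewrite dot_charvec2 finset.setTI (basis_rank (rb k)).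
by rewrite -big_distrl /= => /(canRL (mulfK rank_neq0)) ->; rewrite divff.
Qed.

Lemma flat_faceT : flat_face M setN = P.
Proof.
apply/seteqP; split=> x; first by case/flat_faceE.
by move=> Px; apply/flat_faceE; rewrite polytope_sum.
Qed.

Lemma aff_rank_flat_face F : aff_rank (flat_face (R := R) M F) (\rank (face_mx F)).
Proof.
apply: (@aff_rank_rows _ _ _ _ _ (charvec R setN) (rank M)%:R) => //.
- by move=> x /flat_faceE[/polytope_sum].
- by move=> i; rewrite rowK; apply: flat_face_basis; exact: enum_valP.
- by move=> x; exact: flat_face_face_mx.
Qed.

Section ConnectedFlat.
Variable F : {set 'I_n}.
Hypotheses (rconF : rconnected M F) (cconF : cconnected M F).
Hypotheses (F0 : F != finset.set0) (rkF : (rk M F < rank M)%N).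

(** The normal vector of the [F]-hyperplane, which passes through the origin. It spans the forms
    vanishing on the face, so the face has codimension 1. *)
Let w : V := (rank M)%:R *: charvec R F - (rk M F)%:R *: charvec R setN.

Lemma face_mx_rank : (\rank (face_mx F)).+1 = n.
Proof.
have rk_lt : ((rk M F)%:R : R) < (rank M)%:R by rewrite ltr_nat.
have /set0Pn[i iF] := F0.
have [j jF] := rk_lt_notin rkF.
have wi k : w 0 k = (rank M)%:R * (k \in F)%:R - (rk M F)%:R.
  by rewrite !mxE inE mulr1.
have w0 : w != 0.
  apply/eqP => /rowP/(_ i); rewrite wi iF mxE mulr1 => /eqP.
  by rewrite subr_eq0 gt_eqF.
have := @mxrank_kertr _ _ _ (face_mx F) w; rewrite w0 addn1; apply=> a.
split=> [e|[t ->]]; last first.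
  apply/face_mx_ker => B; rewrite inE => /andP[Bb /eqP FB].
  rewrite dotZl dotDl dotNl !dotZl !dot_charvec2 FB finset.setTI (basis_rank Bb).
  ring.
have [/(_ rconF) cF /(_ cconF) cC] := face_const e.
have aE : a = a 0 j *: charvec R setN + (a 0 i - a 0 j) *: charvec R F.
  apply/rowP => k; rewrite !mxE inE mulr1.
  have [kF|kF] := boolP (k \in F).
    by rewrite (cF k i) //= mulr1 subrKC.
  by rewrite (cC k j) //= mulr0 addr0.
have [B Bb FB] := rk_witness M F.
have := (face_mx_ker _ _).1 e B; rewrite inE Bb FB eqxx => /(_ isT).
rewrite {1}aE dotDl !dotZl !dot_charvec2 FB finset.setTI (basis_rank Bb) => e1.
move: e1 aE; set u := a 0 i - a 0 j => e1 aE; exists (u / (rank M)%:R).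
have aj : a 0 j = - (u * (rk M F)%:R) / (rank M)%:R.
  by apply: (mulIf rank_neq0); rewrite divfK //; lra.
rewrite {1}aE aj /w.
apply/rowP => k; rewrite !mxE inE; field; exact: rank_neq0.
Qed.

Lemma connected_flacet : flacet R M F.
Proof.
have flF : flat M F by exact: cconnected_flat.
have eqrk : (\rank (face_mx F)).+1 = \rank (face_mx setN).
  by rewrite face_mx_rank; apply/esym/eqP; exact: face_mxT_full.
split=> //.
  split.
    exists (charvec R F), (rk M F)%:R; split; first exact: polytope_le.
    by apply/seteqP; split=> x; [case/flat_faceE|move=> ?; exact/flat_faceE].
  exists (\rank (face_mx F)); split; last exact: aff_rank_flat_face.
  by rewrite eqrk -flat_faceT; exact: aff_rank_flat_face.
move=> G flG eG GF; apply/eqP; rewrite finset.eqEsubset GF /=; apply: contraT.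
move=> /subsetPn[j jF jG].
(* If [G] is nonempty and defines the same face, its normal [v] must be constant on [F], although
   its values inside and outside [G] differ by [rank M]. An empty [G] would define the whole
   polytope, whose affine rank is larger. *)
pose v : V := (rank M)%:R *: charvec R G - (rk M G)%:R *: charvec R setN.
have vE k : v 0 k = (rank M)%:R * (k \in G)%:R - (rk M G)%:R.
  by rewrite !mxE inE mulr1.
have vB B : B \in bases M -> flat_face M G (charvec R B) -> dot v (charvec R B) = 0.
  move=> Bb /flat_faceE[_ e]; rewrite dotDl dotNl !dotZl e.
  by rewrite dot_charvec2 finset.setTI (basis_rank Bb) mulrC subrr.
have [G0|/set0Pn[i iG]] := eqVneq G finset.set0.
  have GP : flat_face M G = P.
    apply/seteqP; split=> x; first by case/flat_faceE.
    move=> Px; apply/flat_faceE; split=> //.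
    have r0 : rk M G = 0%N by apply/eqP; rewrite -leqn0 G0 (leq_trans (rk_card _ _)) ?cards0.
    rewrite r0 G0; apply: (etrans _ (dot0l x)); congr (dot _ x).
    by apply/rowP => k; rewrite !mxE inE.
  have [_ maxF] := aff_rank_flat_face F; have := aff_rank_flat_face setN.
  by rewrite flat_faceT -GP eG -eqrk => -[[q indq Aq] _]; case: (maxF q Aq indq).
have e : v *m (face_mx F)^T = 0.
  apply/face_mx_ker => B BF; apply: vB; last by rewrite eG; exact: flat_face_basis.
  by move: BF; rewrite inE => /andP[].
have := (face_const e).1 rconF i j (fintype.subsetP GF _ iG) jF.
rewrite !vE iG (negPf jG) mulr1 mulr0 => /addIr/eqP.
by rewrite (negPf rank_neq0).
Qed.

End ConnectedFlat.

Hypothesis n_ge2 : (2 <= n)%N.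

(** The set [[set i]] is not a separator, so [i] is neither a loop nor a coloop. *)
Lemma rk_single i : rk M [set i] = 1%N /\ rk M [set~ i]%SET = rank M.
Proof.
have := conM (A := [set i]%SET); rewrite -card_gt0 cards1 => /(_ isT).
rewrite properEcard finset.subsetT cards1 cardsT card_ord n_ge2 => /(_ isT).
rewrite finset.setTD -[rk M setN]/(rank M).
have := rk_card M [set i]; have := rk_rank M (~: [set i])%SET; rewrite cards1.
by move: (rk _ _) (rk _ _) (rank _); clear; lia.
Qed.

(** The characteristic vectors of a basis containing [i] and of one avoiding it differ by a
    direction of the affine hull that moves coordinate [i]; both signs are possible at a relatively
    interior point, so it avoids every wall of the cube. *)
Lemma relint_polytopeP x : relint (aff P `&` cube) x <->
  sum setN x = (rank M)%:R /\ forall i, 0 < x 0 i < 1.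
Proof.
have affS y : aff P y <-> sum setN y = (rank M)%:R.
  by split; [apply: aff_dot_eq; exact: polytope_sum|exact: aff_polytope].
split=> [[[/affS xd x01] /nbhs_ballP[e /= e0 xe]]|[xd x01]].
  split=> // i; have [r1 rC] := rk_single i.
  have [B Bb iB] := rk_witness M [set i]; have [C Cb iC] := rk_witness M [set~ i]%SET.
  have {}iB : i \in B.
    move: iB; rewrite r1; apply: contra_eqT => iB.
    by rewrite disjoint_setI0 ?cards0 // disjoints1.
  have {}iC : i \notin C.
    move: iC; rewrite rC; apply: contra_eqN => iC.
    rewrite neq_ltn -(basis_rank Cb) proper_card //; apply/properP; split.
      exact: finset.subsetIr.
    by exists i; rewrite // !inE eqxx.
  pose v := charvec R B - charvec R C.
  have vi : v 0 i = 1 by rewrite !mxE iB (negPf iC) subr0.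
  have cubeB D : cube (charvec R D).
    by move=> k; rewrite mxE; case: (_ \in _); rewrite lexx ler01.
  have sB D : D \in bases M -> (aff P `&` cube) (charvec R D).
    by move=> Db; split=> //; apply: sub_aff; exact: polytope_basis.
  have move t : `|t| < e -> 0 <= x 0 i + t <= 1.
    move=> te; have : (aff P `&` cube) (x + t *: v).
      apply: xe.
        split=> // j k; rewrite ord1 /ball /= !mxE opprD addNKr normrN normrM.
        apply: le_lt_trans te; rewrite -[leRHS]mulr1 ler_wpM2l //.
        by do 2!case: (_ \in _); rewrite ?subrr ?subr0 ?sub0r ?normrN ?normr0 ?normr1 ?ler01.
      pose J := ('I_1 + ('I_1 + 'I_1))%type.
      pose p (s : J) := match s with inl _ => x | inr (inl _) => charvec R B
                        | inr (inr _) => charvec R C end.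
      pose c (s : J) := match s with inl _ => 1 | inr (inl _) => t | inr (inr _) => - t end.
      have -> : x + t *: v = \sum_s c s *: p s.
        by rewrite !big_sumType /= !big_ord1 scale1r scaleNr -scalerBr.
      apply: aff_fin => [[_|[_|_]] _ /=|]; [|exact: sB|exact: sB|].
        by split=> //; apply/affS.
      by rewrite !big_sumType /= !big_ord1 subrr addr0.
    by move=> [_ /(_ i)]; rewrite mxE [X in _ + X]mxE vi mulr1.
  have := move (e / 2); have := move (- (e / 2)).
  rewrite normrN gtr0_norm ?divr_gt0 // ltr_pdivrMr // ltr_pMr // ltr1n.
  by move=> /(_ isT) h1 /(_ isT) h2; apply/andP; split; lra.
split; first by split; [exact/affS|move=> i; have /andP[/ltW -> /ltW ->] := x01 i].
(* With [v] constantly 1, [e] is a common lower bound for the distances to the walls. *)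
have [|e e0 He] := @small_step R ('I_n * bool)%type
    (fun k => if k.2 then x 0 k.1 else 1 - x 0 k.1) (fun=> 1).
  by move=> [i s] /=; have /andP[] := x01 i; case: s; rewrite ?subr_gt0.
apply/nbhs_ballP; exists e => //= y [_ xy] yA; split.
  by apply/affS; apply: aff_dot_eq yA => z [/affS].
move=> i; have {}xy : `|x 0 i - y 0 i| < e := xy 0 i.
have := He (x 0 i - y 0 i) (ltW xy) (i, false).
have := He (y 0 i - x 0 i) _ (i, true); rewrite distrC ltW //= !mulr1.
by move=> /(_ isT) h1 h2; apply/andP; split; lra.
Qed.

(* The [F]-hyperplane meets the interior of the hypersimplex: [B] witnesses
   [rk F < #|F|], and [rank - rk F < #|~: F|] since [M] has no coloops. *)
Lemma connected_split_flacet F B : rconnected M F -> cconnected M F ->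
  #|B| = rank M -> (rk M F < #|B :&: F|)%N -> split_flacet R M F.
Proof.
move=> rconF cconF cB ltF.
have leB : (#|B :&: F| <= rank M)%N by rewrite -cB subset_leq_card ?finset.subsetIl.
have leF : (#|B :&: F| <= #|F|)%N by rewrite subset_leq_card ?finset.subsetIr.
have F0 : F != finset.set0 by rewrite -card_gt0; lia.
have rkF : (rk M F < rank M)%N by lia.
split; first exact: connected_flacet.
have [i iF] := set0Pn _ F0.
have rkF0 : (0 < rk M F)%N.
  by have := @rkS _ M [set i] F; rewrite (rk_single i).1 finset.sub1set; apply.
apply: hypersimplex_split; rewrite ?rkF0 ?rkF //; first by lia.
have [e eF] := rk_lt_notin rkF.
have := rk_submod M F (~: F :\ e)%SET; have := rk_card M (~: F :\ e)%SET.
have -> : (F :|: ~: F :\ e = [set~ e])%SET.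
  apply/setP => k; rewrite !inE; case: eqVneq => [->|_] /=; last by case: (k \in F).
  by rewrite (negPf eF).
have := cardsC F; rewrite card_ord (cardsD1 e (~: F)%SET) inE eF (rk_single e).2.
lia.
Qed.

End MatroidPolytope.

(** * Paving matroids *)

Section Main.
Context (R : realType) (n : nat) (M : matroid 'I_n).
Local Notation V := 'rV[R]_n.
Local Notation setN := [set: 'I_n]%SET.
Local Notation sum F x := (dot (charvec R F) x).
Implicit Types (B C D F G H K L : {set 'I_n}) (x y a : V).

Lemma flat_hyperplaneP F x : sum setN x = (rank M)%:R ->
  flat_hyperplane M F x <->
  dot ((rank M)%:R *: charvec R F - (rk M F)%:R *: charvec R setN) x = 0.
Proof.
move=> xd; rewrite /flat_hyperplane /= sum_coordC -dot_charvec dotDl dotNl !dotZl xd.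
by split=> h; lra.
Qed.

Lemma flat_hyperplane_sum F x : (0 < rank M)%N -> sum setN x = (rank M)%:R ->
  flat_hyperplane M F x <-> sum F x = (rk M F)%:R.
Proof.
move=> d0 xd; have d0R : (rank M)%:R != 0 :> R by rewrite pnatr_eq0 -lt0n.
rewrite flat_hyperplaneP // dotDl dotNl !dotZl xd.
by split=> [h|->]; [apply: (mulfI d0R)|]; lra.
Qed.

Lemma hypersimplex_basis B : B \in bases M ->
  hypersimplex (rank M) (charvec R B).
Proof.
move=> Bb; split=> [i|]; first by rewrite mxE; case: (_ \in _); rewrite lexx ler01.
by rewrite /= sum_coord dot_charvec2 finset.setTI (basis_rank Bb).
Qed.

Lemma not_split_flat F :
  (forall x, hypersimplex (rank M) x -> sum F x <= (rk M F)%:R) ->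
  ~ defines_split (hypersimplex (rank M)) (flat_hyperplane (R := R) M F).
Proof.
move=> le spl.
pose a : V := (rank M)%:R *: charvec R F - (rk M F)%:R *: charvec R setN.
have aE x : sum setN x = (rank M)%:R -> dot a x = (rank M)%:R * (sum F x - (rk M F)%:R).
  by move=> xd; rewrite dotDl dotNl !dotZl xd; ring.
have Hs x : hypersimplex (rank M) x -> sum setN x = (rank M)%:R.
  by case=> _ /=; rewrite sum_coord.
apply: (@not_split_one_side _ _ _ _ a 0 spl).
- by move=> x xaff; apply: flat_hyperplaneP; apply: aff_dot_eq xaff.
- have [B Bb FB] := rk_witness M F; exists (charvec R B).
    by apply: sub_aff; exact: hypersimplex_basis.
  by rewrite aE ?Hs ?dot_charvec2 ?FB ?subrr ?mulr0 //; exact: hypersimplex_basis.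
- by move=> x xH; rewrite aE ?Hs // mulr_ge0_le0 // subr_le0 le.
Qed.

Lemma paving_split_flacet F : paving M -> split_flacet R M F ->
  ((rk M F).+1 = rank M)%N.
Proof.
move=> pav [[flF _ _] spl]; have := rk_rank M F.
rewrite leq_eqVlt => /orP[/eqP eF|].
  exfalso; apply: (not_split_flat _ spl) => x [_ /=]; rewrite sum_coord.
  by rewrite eF (flat_rank flF eF) => ->.
rewrite leq_eqVlt => /orP[/eqP //|ltF].
exfalso; apply: (not_split_flat _ spl) => x [x01 _].
rewrite (paving_small pav ltF) dot_charvec -sum1_card natr_sum ler_sum // => i _.
by case/andP: (x01 i).
Qed.

Lemma paving_split_matroid : rconnected M setN -> (0 < rank M)%N -> (2 <= n)%N ->
  paving M -> split_matroid R M.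
Proof.
move=> conM d0 n2 pav F G sF sG FG x /(relint_polytopeP conM d0 n2)[xd x01].
rewrite !flat_hyperplane_sum // => -[xF xG].
have rF := paving_split_flacet pav sF; have rG := paving_split_flacet pav sG.
have [[[flF _ _] _] [[flG _ _] _]] := (sF, sG).
have rU : rk M (F :|: G)%SET = rank M.
  have : (rk M F < rk M (F :|: G)%SET)%N.
    have [GF|] := boolP (G \subset F); last exact: flat_rk_lt.
    have /(flat_rk_lt flG) : ~~ (F \subset G).
      by apply: contra_notN FG => FsG; apply/eqP; rewrite finset.eqEsubset FsG.
    by rewrite finset.setUC; lia.
  by have := rk_rank M (F :|: G)%SET; lia.
have sub := rk_submod M F G.
have rI : rk M (F :&: G)%SET = #|F :&: G|%SET by apply: paving_small => //; lia.
have sumUI : sum (F :|: G)%SET x + sum (F :&: G)%SET x = sum F x + sum G x.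
  rewrite -!dotDl; congr (dot _ x); apply/rowP => i; rewrite !mxE !inE.
  by case: (i \in F); case: (i \in G); rewrite /= ?addr0 ?add0r.
have sumC : sum setN x = sum (F :|: G)%SET x + sum (~: (F :|: G))%SET x.
  by rewrite charvecC dotDl dotNl addrCA subrr addr0.
have sC0 : 0 <= sum (~: (F :|: G))%SET x.
  by rewrite dot_charvec sumr_ge0 // => i _; case/andP: (x01 i) => /ltW.
have sI1 : sum (F :&: G)%SET x <= #|(F :&: G)%SET|%:R.
  rewrite dot_charvec -sum1_card natr_sum ler_sum // => i _.
  by case/andP: (x01 i) => _ /ltW.
have rFR : (rk M F)%:R = (rank M)%:R - 1 :> R by rewrite -rF -natr1 addrK.
have rGR : (rk M G)%:R = (rank M)%:R - 1 :> R by rewrite -rG -natr1 addrK.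
have cI : (#|(F :&: G)%SET|%:R : R) <= (rank M)%:R - 2.
  have : (#|(F :&: G)%SET| + 2 <= rank M)%N by lia.
  by rewrite -(ler_nat R) natrD; lra.
rewrite xF xG rFR rGR in sumUI; rewrite xd in sumC.
(* All estimates are equalities. As every coordinate is strictly between 0 and 1, [F] and [G] are
   complementary, the rank is 2, and two parts of rank 1 separate [M]. *)
have eC : sum (~: (F :|: G))%SET x == 0 by apply/eqP; lra.
have eI : \sum_(i in (F :&: G)%SET) (1 - x 0 i) == 0.
  rewrite sumrB -dot_charvec sumr_const; apply/eqP; lra.
have FGU : (F :|: G)%SET = setN.
  apply/setP => i; rewrite [RHS]inE; apply/negbNE/negP => iU.
  move: eC; rewrite dot_charvec psumr_eq0 => [/allP/(_ i (mem_index_enum i))|j _].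
    by rewrite inE iU gt_eqF //; case/andP: (x01 i).
  by case/andP: (x01 j) => /ltW.
have FGI : (F :&: G)%SET = finset.set0.
  apply/setP => i; rewrite [RHS]inE; apply/negP => iI.
  move: eI; rewrite psumr_eq0 => [/allP/(_ i (mem_index_enum i))|j _].
    by rewrite iI subr_eq0 gt_eqF //; case/andP: (x01 i).
  by rewrite subr_ge0; case/andP: (x01 j) => _ /ltW.
have d2 : rank M = 2%N.
  apply/eqP; rewrite -(eqr_nat R); apply/eqP.
  have := sI1; have e0 : sum (F :&: G)%SET x = 0.
    by rewrite FGI dot_charvec big_set0.
  lra.
have GE : G = (~: F)%SET.
  apply/setP => i; have := finset.in_setT i; rewrite -FGU; have := finset.in_set0 i.
  by rewrite -FGI !inE; case: (i \in F); case: (i \in G).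
have F0 : F != finset.set0.
  apply: contra_eq_neq rF => ->; have := rk_card M finset.set0.
  by rewrite cards0 d2 leqn0 => /eqP ->.
have FT : F \proper setN.
  rewrite properT; apply: contra_eq_neq rF => ->.
  by rewrite -[rk M setN]/(rank M) -[X in X != _]addn1 -[X in _ != X]addn0 eqn_add2l.
have := conM F F0 FT; rewrite finset.setTD -GE -[rk M setN]/(rank M).
by move: rF rG d2; clear; lia.
Qed.

(** Mass [r - dl] is spread evenly on the intersection, [dl] on each difference and [1 - dl] outside
    the union. The bound [2 <= r] keeps the first mass positive even for [dl = 1]. *)
Lemma interior_common_point F G (r : nat) : (2 <= r)%N -> (r <= #|F :&: G|)%N ->
  F :\: G != finset.set0 -> G :\: F != finset.set0 ->
  #|(~: F)%SET| != 1%N -> #|(~: G)%SET| != 1%N ->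
  exists x, [/\ forall i, 0 < x 0 i < 1, sum setN x = r.+1%:R, sum F x = r%:R
    & sum G x = r%:R].
Proof.
move=> r2; set A := (F :&: G)%SET; set X := (F :\: G)%SET; set Y := (G :\: F)%SET.
rewrite -!card_gt0 => A1 X0 Y0 F1 G1; pose Z := (~: (F :|: G))%SET.
have cG : #|(~: G)%SET| = (#|X| + #|Z|)%N.
  rewrite -(cardsID F (~: G)%SET); congr (_ + _)%N; apply: eq_card => i;
  by rewrite !inE; case: (i \in F); case: (i \in G).
have cF : #|(~: F)%SET| = (#|Y| + #|Z|)%N.
  rewrite -(cardsID G (~: F)%SET); congr (_ + _)%N; apply: eq_card => i;
  by rewrite !inE; case: (i \in F); case: (i \in G).
rewrite cF cG in F1 G1.
(* If the union is everything, [dl] must be 1; each difference is then the complement of [F] or [G],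
   so it has at least two elements. Otherwise 1/2 leaves mass outside and is less than the size of
   any nonempty set. *)
have [dl [dl0 dl1 dlX dlY dlZ]] : exists dl : R, [/\ 0 < dl, dl <= 1, dl < #|X|%:R,
    dl < #|Y|%:R & if #|Z| == 0%N then dl = 1 else dl = 1 / 2].
  have [z0|_] := eqVneq #|Z| 0%N; last first.
    have X1 : (1 : R) <= #|X|%:R by rewrite ler1n.
    have Y1 : (1 : R) <= #|Y|%:R by rewrite ler1n.
    by exists (1 / 2); split=> //; lra.
  rewrite z0 !addn0 in F1 G1; exists 1; split=> //; by rewrite ltr1n ltn_neqAle eq_sym ?F1 ?G1.
have r2R : (2 : R) <= r%:R by rewrite (ler_nat R 2).
have A1R : (r%:R : R) <= #|A|%:R by rewrite ler_nat.
pose z : R := if #|Z| == 0%N then 0 else (1 - dl) / #|Z|%:R.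
have zZ : z * #|Z|%:R = 1 - dl.
  rewrite /z; move: dlZ; case: eqP => [-> ->|/eqP z0 _]; first by rewrite mul0r subrr.
  by rewrite divfK // pnatr_eq0.
have cX0 : (0 : R) < #|X|%:R by rewrite ltr0n.
have cY0 : (0 : R) < #|Y|%:R by rewrite ltr0n.
have cA0 : (0 : R) < #|A|%:R by lra.
pose cf i : R := match i \in F, i \in G with
  | true, true => (r%:R - dl) / #|A|%:R | true, false => dl / #|X|%:R
  | false, true => dl / #|Y|%:R | false, false => z end.
pose x : V := \row_i cf i.
have sumK K (c : R) : (forall i, i \in K -> cf i = c) -> sum K x = c * #|K|%:R.
  move=> Kc; rewrite dot_charvec mulr_natr -sumr_const.
  by apply: eq_bigr => i /Kc; rewrite mxE.
have xA : sum A x = r%:R - dl.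
  rewrite (@sumK A ((r%:R - dl) / #|A|%:R)) ?divfK ?gt_eqF // => i.
  by rewrite inE /cf => /andP[-> ->].
have xX : sum X x = dl.
  rewrite (@sumK X (dl / #|X|%:R)) ?divfK ?gt_eqF // => i.
  by rewrite inE /cf => /andP[/negPf -> ->].
have xY : sum Y x = dl.
  rewrite (@sumK Y (dl / #|Y|%:R)) ?divfK ?gt_eqF // => i.
  by rewrite inE /cf => /andP[/negPf -> ->].
have xZ : sum Z x = 1 - dl.
  rewrite (@sumK Z z) // => i.
  by rewrite !inE negb_or /cf => /andP[/negPf -> /negPf ->].
have sumD H K : sum H x = sum (H :&: K)%SET x + sum (H :\: K)%SET x.
  by rewrite !dot_charvec (big_setID K).
have xF : sum F x = r%:R by rewrite (sumD F G) xA xX subrK.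
have xG : sum G x = r%:R by rewrite (sumD G F) finset.setIC xA xY subrK.
have xGC : sum (~: G)%SET x = 1.
  have e1 : (~: G :&: F = X)%SET by rewrite finset.setIC -finset.setDE.
  have e2 : (~: G :\: F = Z)%SET by rewrite finset.setDE -finset.setCU finset.setUC.
  by rewrite (sumD (~: G)%SET F) e1 e2 xX xZ addrC subrK.
exists x; split=> //; last first.
  by rewrite (sumD setN G) finset.setTI finset.setTD xG xGC natr1.
move=> i; have frac01 (p q : R) : 0 < p -> p < q -> 0 < p / q < 1.
  move=> p0 pq; have q0 := lt_trans p0 pq.
  by apply/andP; split; [exact: divr_gt0|rewrite ltr_pdivrMr // mul1r].
rewrite mxE /cf; case iF: (i \in F); case iG: (i \in G).
- by apply: frac01; lra.
- exact: frac01.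
- exact: frac01.
have Z0 : (0 < #|Z|)%N by apply/card_gt0P; exists i; rewrite !inE iF iG.
have Z1 : (1 : R) <= #|Z|%:R by rewrite ler1n.
rewrite /z; move: dlZ; rewrite -[_ == 0%N]negbK -lt0n Z0 /= => dlE.
by apply: frac01; lra.
Qed.

Lemma split_paving : rconnected M setN -> (0 < rank M)%N -> (2 <= n)%N ->
  split_matroid R M ->
  (forall F, split_flacet R M F -> ((rk M F).+1 = rank M)%N) -> paving M.
Proof.
move=> conM d0 n2 split_M flacet_rk C circC.
have leC := circuit_rank circC.
have [ltC|] := ltnP #|C| (rank M); last by lia.
exfalso; have [depC _] := circuitP circC.
(* There are no loops. With [#|C| < rank M] this gives [2 <= rank M - 1], as needed for the common
   point. *)
have C2 : (1 < #|C|)%N.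
  have := rk_circuit circC; case: (posnP (rk M C)) => [r0|]; last by lia.
  rewrite r0 => /esym/eqP/cards1P[i Ci].
  by move: r0; rewrite Ci (rk_single conM n2 i).1.
have [D [CD cD]] : exists D : {set 'I_n}, C \subset D /\ (#|D|.+1 = rank M)%N.
  pose ok D := (C \subset D) && (#|D| < rank M)%N.
  have okC : ok C by rewrite /ok fintype.subxx.
  case: (@arg_maxnP _ C ok (fun D => #|D|) okC) => D /andP[CD ltD] maxD.
  exists D; split=> //; apply/eqP; rewrite eqn_leq ltD /= leqNgt; apply/negP => lt.
  have [i iD] := rk_lt_notin (leq_ltn_trans (rk_card M D) ltD).
  have := maxD (i |: D)%SET; rewrite /ok cardsU1 iD add1n lt (fintype.subset_trans CD) ?finset.subsetUr //.
  by move=> /(_ isT) /=; rewrite ltnn.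
have cover e : e \notin D ->
    exists F, [/\ split_flacet R M F, D \subset F & e \in F].
  move=> eD; have cB : #|(e |: D)%SET| = rank M by rewrite cardsU1 eD add1n.
  have Bnb : (e |: D)%SET \notin bases M.
    apply: contra depC => Bb; apply/exists_inP; exists (e |: D)%SET => //.
    by rewrite (fintype.subset_trans CD) ?finset.subsetUr.
  have [F [cF ccF ltF]] := violated_flat conM cB Bnb.
  have sF : split_flacet R M F by exact: (connected_split_flacet R conM d0 n2 cF ccF cB ltF).
  have : (e |: D \subset F)%SET.
    apply/finset.setIidPl/eqP; rewrite eqEcard finset.subsetIl cB.
    by rewrite -(flacet_rk _ sF).
  by rewrite finset.subUset finset.sub1set => /andP[eF DF]; exists F.
have [b bD] := rk_lt_notin (leq_ltn_trans (rk_card M D) (eq_leq cD)).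
have [F [sF DF _]] := cover b bD; have rF := flacet_rk F sF.
have [c cF] := rk_lt_notin (eq_leq rF).
have cD' : c \notin D by apply: contra cF => /(fintype.subsetP DF).
have [G [sG DG cG]] := cover c cD'; have rG := flacet_rk G sG.
have FG : F <> G by move=> e; rewrite e cG in cF.
have [[[flF _ _] _] [[flG _ _] _]] := (sF, sG).
have F_G : ~~ (F \subset G).
  apply/negP => FsG; have := flat_rk_lt flF (G := G).
  have -> : (F :|: G = G)%SET by apply/finset.setUidPr.
  have -> : ~~ (G \subset F) by apply/fintype.subsetPn; exists c.
  by move=> /(_ isT); rewrite -ltnS rF rG ltnn.
(* A single missing element would be a coloop. *)
have coclosed H : (rk M H).+1 = rank M -> #|(~: H)%SET| != 1%N.
  move=> rH; apply/cards1P => -[i Hi].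
  by move/eqP: rH; rewrite -[H]finset.setCK Hi (rk_single conM n2 i).2 eqn_leq ltnn.
have rFG : rk M F = rk M G by apply: succn_inj; rewrite rF rG.
have [||||||x [x01 xd xF xG]] := @interior_common_point F G (rk M F).
- by move: C2 ltC rF; clear; lia.
- apply: (@leq_trans #|D|); first by move: cD rF; clear; lia.
  by rewrite subset_leq_card // finset.subsetI DF.
- by rewrite finset.setD_eq0.
- by rewrite finset.setD_eq0; apply/fintype.subsetPn; exists c.
- exact: coclosed.
- exact: coclosed.
rewrite rF in xd; apply: (split_M F G sF sG FG x).
  exact/(relint_polytopeP conM d0 n2).
by rewrite !flat_hyperplane_sum // -rFG.
Qed.

End Main.

Theorem theorem19 (R : realType) (n d : nat) (M : matroid 'I_n)
    (n_ge2 : (2 <= n)%N) (rkM : rank M = d) (connM : mconnected M) :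
  paving M <->
  split_matroid R M /\
  (forall F : {set 'I_n}, split_flacet R M F -> ((rk M F).+1 = d)%N).
Proof.
have conM := mconnected_rk connM.
have d0 : (0 < rank M)%N.
  have := rk_rank M [set Ordinal (ltnW n_ge2)]%SET.
  by rewrite (rk_single conM n_ge2 _).1.
rewrite -rkM; split=> [pav|[splM rkF]]; last exact: split_paving splM rkF.
by split=> [|F]; [exact: paving_split_matroid|exact: paving_split_flacet].
Qed.
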